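(* Let $\mathcal H$ be a Hilbert space, let $V \subseteq B(\mathcal H)$ be an operator space, and let $V^{\dagger\dagger}$ denote the weak*-closure of $V$ in $B(\mathcal H)$. Then the following are equivalent: (i) $V$ has a weak expectation, i.e. there is a completely contractive map from $B(\mathcal H)$ into $V^{\dagger\dagger}$ that is the identity on $V$; (ii) $I_{V^{\dagger\dagger}}(V) = I(V)$, i.e. these spaces are completely isometrically isomorphic via a map that fixes $V$; (iii) $I_{V^{\dagger\dagger}}(V)$ is an injective operator space (in the usual sense).
   Context: $I(V)$ is the usual injective envelope of the operator space $V$ (an injective operator space containing $V$ such that the only completely contractive self-map fixing $V$ is the identity). For operator spaces $V\subseteq W$, a $V$-map is a completely contractive (linear) map $\phi:W\to W$ with $\phi(v)=v$ for all $v\in V$; it induces a seminorm $p_\phi(w)=\|\phi(w)\|$ on $W$, and these seminorms ($V$-seminorms) are ordered pointwise. When $W$ is a dual operator space (e.g. $W=V^{\dagger\dagger}$), minimal $V$-seminorms exist; a $V$-map $E$ with $p_E$ minimal is automatically idempotent and is called a minimal $V$-projection (with respect to $W$). Two subspaces $X,Y\subseteq W$ are $W$-isomorphic if there are completely contractive maps $\phi,\psi:W\to W$ with $\phi(X)\subseteq Y$, $\psi(Y)\subseteq X$, $\psi\circ\phi=\mathrm{id}$ on $X$ and $\phi\circ\psi=\mathrm{id}$ on $Y$. The ranges of any two minimal $V$-projections are $W$-isomorphic, and the $W$-injective envelope $I_W(V)$ denotes the $W$-isomorphism class of the range of a minimal $V$-projection. *)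

(* Defs.v *)
From HB Require Import structures.
From mathcomp Require Import all_boot all_order all_algebra.
From mathcomp Require Import all_classical all_reals all_analysis.
From mathcomp Require Import complex.

Set Implicit Arguments.
Unset Strict Implicit.
Unset Printing Implicit Defensive.

Import Order.TTheory GRing.Theory Num.Theory.
Import numFieldNormedType.Exports.

Local Open Scope classical_set_scope.
Local Open Scope ring_scope.
Local Open Scope complex_scope.

HB.mixin Record CompleteNormedModule_isHilbert (R : realType) H
    of CompleteNormedModule R[i] H := {
  inner : {dot H for (@Num.conj R[i])} ;
  inner_norm : forall x : H, inner x x = `|x| ^+ 2
}.

#[short(type="hilbertType")]
HB.structure Definition Hilbert (R : realType) :=
  {H of CompleteNormedModule_isHilbert R H & CompleteNormedModule R[i] H}.

Section OperatorNorms.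
Variables (R : realType) (H : hilbertType R).

(* The library norm of [x : H] is a (nonnegative real) element of [R[i]]. *)
Definition hnorm (x : H) : R := complex.Re `|x|.

(* B(H), as a set of functions. *)
Definition bounded_operators : set (H -> H) :=
  [set T | linear T /\ continuous T].

Definition opnorm (T : H -> H) : R :=
  sup [set hnorm (T x) | x in [set x | hnorm x <= 1]].

Definition l2norm n (x : 'I_n -> H) : R :=
  Num.sqrt (\sum_(i < n) hnorm (x i) ^+ 2).

Definition mxact n (A : 'M[H -> H]_n) (x : 'I_n -> H) : 'I_n -> H :=
  fun i => \sum_(j < n) A i j (x j).

(* The norm of M_n(B(H)) = B(H^n). *)
Definition mxopnorm n (A : 'M[H -> H]_n) : R :=
  sup [set l2norm (mxact A x) | x in [set x | l2norm x <= 1]].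

(* Concrete operator spaces; norm-closedness is not required. *)
Definition operator_space (X : set (H -> H)) : Prop :=
  [/\ X `<=` bounded_operators, X 0 &
      forall (a : R[i]) S T, X S -> X T -> X (a *: S + T)].

Definition square_summable (x : nat -> H) : Prop :=
  cvgn (series (fun k => hnorm (x k) ^+ 2)).

(* The functionals T |-> sum_k <T x_k, y_k> with (x_k), (y_k) square summable
   are exactly the elements of the predual of B(H), i.e. the functionals
   T |-> tr(T c) with c of trace class. *)
Definition normal_functional (x y : nat -> H) (T : H -> H) : R[i] :=
  limn (series (fun k => inner (T (x k)) (y k) : R[i]^o)).

Definition weakstar_closure (V : set (H -> H)) : set (H -> H) :=
  [set T | bounded_operators T /\
    forall m (x y : 'I_m -> nat -> H),
      (forall l, square_summable (x l)) -> (forall l, square_summable (y l)) ->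
    forall e : R, 0 < e ->
    exists2 S, V S & forall l, complex.Re `|normal_functional (x l) (y l) T
                                 - normal_functional (x l) (y l) S| < e].

End OperatorNorms.

(* Maps between operator spaces X <= B(H) and Y <= B(K) are represented by total
   functions (H -> H) -> (K -> K); only their values on X are relevant. *)
Section CompleteMaps.
Variables (R : realType) (H K : hilbertType R).
Implicit Types (X : set (H -> H)) (Y : set (K -> K)).
Implicit Types phi : (H -> H) -> (K -> K).

Definition linear_map X Y phi : Prop :=
  (forall T, X T -> Y (phi T)) /\
  (forall (a : R[i]) S T, X S -> X T ->
     phi (a *: S + T) = a *: phi S + phi T).

Definition completely_contractive X Y phi : Prop :=
  linear_map X Y phi /\
  forall n (A : 'M[H -> H]_n), (forall i j, X (A i j)) ->
    mxopnorm (map_mx phi A) <= mxopnorm A.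

Definition completely_isometric X Y phi : Prop :=
  linear_map X Y phi /\
  forall n (A : 'M[H -> H]_n), (forall i j, X (A i j)) ->
    mxopnorm (map_mx phi A) = mxopnorm A.

End CompleteMaps.

Section InjectiveEnvelopes.
Variables (R : realType).
Implicit Types H K : hilbertType R.

Definition injective_operator_space H (X : set (H -> H)) : Prop :=
  operator_space X /\
  forall K (Z1 Z2 : set (K -> K)),
    operator_space Z1 -> operator_space Z2 -> Z1 `<=` Z2 ->
  forall phi, completely_contractive Z1 X phi ->
  exists2 psi, completely_contractive Z2 X psi &
    forall T, Z1 T -> psi T = phi T.

(* (Y, iota) is an injective envelope of V, where V is regarded as a subspace
   of Y through the complete isometry iota. *)
Definition injective_envelope H K (V : set (H -> H)) (Y : set (K -> K))
    (iota : (H -> H) -> (K -> K)) : Prop :=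
  [/\ injective_operator_space Y,
      completely_isometric V Y iota &
      forall phi, completely_contractive Y Y phi ->
        (forall T, V T -> phi (iota T) = iota T) ->
        forall T, Y T -> phi T = T].

(* X = I(V), for V <= X. The pair (Y, iota) is unique up to a complete
   isometry fixing V, so its choice is immaterial. *)
Definition iso_injective_envelope H (V X : set (H -> H)) : Prop :=
  exists K (Y : set (K -> K)) iota, injective_envelope V Y iota /\
  exists u, [/\ completely_isometric X Y u, u @` X = Y &
                forall T, V T -> u T = iota T].

Definition V_map H (V W : set (H -> H)) phi : Prop :=
  completely_contractive W W phi /\ forall T, V T -> phi T = T.

Definition minimal_V_projection H (V W : set (H -> H)) E : Prop :=
  V_map V W E /\
  forall phi, V_map V W phi ->
    (forall T, W T -> opnorm (phi T) <= opnorm (E T)) ->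
    forall T, W T -> opnorm (phi T) = opnorm (E T).

Definition has_weak_expectation H (V : set (H -> H)) : Prop :=
  exists2 phi,
    completely_contractive (@bounded_operators R H) (weakstar_closure V) phi &
    forall T, V T -> phi T = T.

End InjectiveEnvelopes.

(* Main.v *)
Require Import Defs.
From HB Require Import structures.
From mathcomp Require Import all_boot all_order all_algebra.
From mathcomp Require Import all_classical all_reals all_analysis.
From mathcomp Require Import complex.
From mathcomp Require Import ring lra.

Set Implicit Arguments.
Unset Strict Implicit.
Unset Printing Implicit Defensive.

Import Order.TTheory GRing.Theory Num.Theory.
Import numFieldNormedType.Exports.

Local Open Scope classical_set_scope.
Local Open Scope ring_scope.
Local Open Scope complex_scope.

(** Let [W] be the weak* closure of [V], let [E] be a minimal V-projection of [W]
    and let [Y] be its range.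

    The key fact is that [E] absorbs every V-map [phi]: the Cesaro means of the
    powers of [phi \o E] have V-seminorms below that of [E], hence equal to it, and
    this forces [E \o phi \o E = E] on [W] ([minimal_V_projection_absorbs]). So [E]
    is idempotent, and a completely contractive map from [Y] to [Y] that fixes [V]
    is the identity ([range_rigid]). Consequently [Y] is an injective envelope of
    [V] as soon as it is injective, and conversely injectivity passes through
    complete isometries; this settles the equivalence of (ii) and (iii). If [Y] is
    injective, its identity map extends to all bounded operators and the extension
    is a weak expectation. If [Phi] is a weak expectation, then [E \o Phi] fixes
    [V], hence [Y] by rigidity; it is thus a completely contractive projection of
    the space of all bounded operators onto [Y], and [Y] inherits the injectivity
    of that space.

    The injectivity of the space of bounded operators is Wittstock's extension
    theorem ([wittstock_extension]). A map from an operator space [Z] into the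
    operators on [H] is a functional on the tensor product of [Z], [H] and the
    conjugate of [H]; it is completely contractive when its real part is at most
    half the sum of the squared norms of [x] and [y] on the tensors
    [sum_ij z_ij (x) x_j (x) y_i] given by a contractive matrix [z]. The
    Hahn-Banach theorem extends such a functional provided that the gauge of a
    tensor over a subspace of [Z] can be computed within the subspace. This holds
    because unitary changes of the families [x] and [y] make each of them
    orthogonal, without changing any norm, and because the entries of the matrix
    can then be recovered from the tensor ([orthogonal_reduction]).

    Minimal V-projections exist by Zorn's lemma, since chains of V-seminorms have
    lower bounds: along an ultrafilter the matrix coefficients of V-maps converge,
    the limits are bounded forms and thus operators, and these stay in [W] because
    normal functionals are uniformly approximated by finite sums on bounded sets
    ([ultralimit_V_map]).

    All estimates are made with the real part [rdot] of the inner product and with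
    [mxbound], which says that a matrix of operators has norm at most [c] by an
    inequality between real numbers. *)

(** * The real inner product of a complex Hilbert space *)

Section RealInnerProduct.
Variables (R : realType) (H : hilbertType R).
Implicit Types (x y z : H) (t : R) (a : R[i]).

Definition rdot x y : R := complex.Re (inner x y).

Lemma rdotDl x y z : rdot (x + y) z = rdot x z + rdot y z.
Proof.
have := linearPl (@inner R H) z 1 x y; rewrite scale1r /rdot => ->.
by rewrite /= mul1r raddfD.
Qed.

Lemma rdotDr x y z : rdot z (x + y) = rdot z x + rdot z y.
Proof.
have := linearPr (@inner R H) z 1 x y; rewrite scale1r /rdot => ->.
by rewrite /= rmorph1 mul1r raddfD.
Qed.

Lemma rdot0l x : rdot 0 x = 0.
Proof. by apply: (addrI (rdot 0 x)); rewrite -rdotDl !addr0. Qed.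

Lemma rdot0r x : rdot x 0 = 0.
Proof. by apply: (addrI (rdot x 0)); rewrite -rdotDr !addr0. Qed.

Lemma innerZl a x y : inner (a *: x) y = a * inner x y.
Proof.
have := linearPl (@inner R H) y a x 0; rewrite addr0 => ->.
by rewrite linear0l addr0.
Qed.

Lemma innerZr a x y : inner x (a *: y) = conjc a * inner x y.
Proof.
have := linearPr (@inner R H) x a y 0; rewrite addr0 => ->.
by rewrite linear0r addr0.
Qed.

Lemma innerC x y : inner x y = conjc (inner y x).
Proof. by rewrite hermC /= expr0 mul1r. Qed.

Lemma rdotC x y : rdot x y = rdot y x.
Proof. by rewrite /rdot innerC; case: (inner y x). Qed.

Lemma rdotZ_conj a x y : rdot (a *: x) y = rdot x (conjc a *: y).
Proof. by rewrite /rdot innerZl innerZr conjcK. Qed.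

Lemma rdotZl t x y : rdot (t%:C *: x) y = t * rdot x y.
Proof.
by rewrite /rdot innerZl; case: (inner x y) => b c; rewrite /= mul0r subr0.
Qed.

Lemma rdotZr t x y : rdot x (t%:C *: y) = t * rdot x y.
Proof. by rewrite rdotC rdotZl rdotC. Qed.

Lemma rdotNl x y : rdot (- x) y = - rdot x y.
Proof. by apply/eqP; rewrite -addr_eq0 -rdotDl addNr rdot0l. Qed.

Lemma rdotNr x y : rdot x (- y) = - rdot x y.
Proof. by rewrite rdotC rdotNl rdotC. Qed.

Lemma rdotBl x y z : rdot (x - y) z = rdot x z - rdot y z.
Proof. by rewrite rdotDl rdotNl. Qed.

Lemma innerE x y : inner x y = rdot x y +i* rdot x ('i *: y).
Proof.
rewrite /rdot innerZr; case: (inner x y) => b c /=.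
by rewrite !mul0r mulN1r opprK add0r.
Qed.

Lemma norm_hnorm x : `|x| = (hnorm x)%:C.
Proof. by rewrite /hnorm RRe_real ?normr_real. Qed.

Lemma hnorm_ge0 x : 0 <= hnorm x.
Proof. by rewrite -lecR -norm_hnorm normr_ge0. Qed.

Lemma hnorm_sqr x : hnorm x ^+ 2 = rdot x x.
Proof. by rewrite /rdot inner_norm norm_hnorm -rmorphXn. Qed.

Lemma rdot_ge0 x : 0 <= rdot x x.
Proof. by rewrite -hnorm_sqr sqr_ge0. Qed.

Lemma hnorm_eq0 x : hnorm x = 0 -> x = 0.
Proof. by move=> x0; apply/eqP; rewrite -normr_eq0 norm_hnorm x0. Qed.

Lemma hnorm_gt0 x : x != 0 -> 0 < hnorm x.
Proof.
move=> x0; rewrite lt_neqAle hnorm_ge0 andbT eq_sym.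
by apply: contra x0 => /eqP/hnorm_eq0 ->.
Qed.

Lemma hnorm0 : hnorm (0 : H) = 0.
Proof. by rewrite /hnorm normr0. Qed.

Lemma rdot_eq0 x : rdot x x = 0 -> x = 0.
Proof. by rewrite -hnorm_sqr => /eqP; rewrite sqrf_eq0 => /eqP/hnorm_eq0. Qed.

Lemma hnormD x y : hnorm (x + y) <= hnorm x + hnorm y.
Proof. by rewrite -lecR rmorphD /= -!norm_hnorm ler_normD. Qed.

Lemma hnormN x : hnorm (- x) = hnorm x.
Proof. by rewrite /hnorm normrN. Qed.

Lemma hnormZ a x : hnorm (a *: x) = complex.Re `|a| * hnorm x.
Proof.
apply: complexI; rewrite -norm_hnorm normrZ norm_hnorm.
by rewrite [RHS]rmorphM; congr (_ * _).
Qed.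

Lemma hnormZr t x : 0 <= t -> hnorm (t%:C *: x) = t * hnorm x.
Proof. by move=> t0; rewrite hnormZ ger0_norm // ler0c. Qed.

Lemma rdot_le_sqr x y : rdot x y <= (hnorm x ^+ 2 + hnorm y ^+ 2) / 2.
Proof.
have := rdot_ge0 (x - y).
by rewrite !(rdotDl, rdotDr, rdotNl, rdotNr) (rdotC y x) !hnorm_sqr; lra.
Qed.

Lemma rdot_le x y : rdot x y <= hnorm x * hnorm y.
Proof.
have [->|x0] := eqVneq x 0; first by rewrite rdot0l hnorm0 mul0r.
have [->|y0] := eqVneq y 0; first by rewrite rdot0r hnorm0 mulr0.
have hx := hnorm_gt0 x0; have hy := hnorm_gt0 y0.
(* the arithmetic-geometric inequality is sharp for vectors of equal norms *)
have := rdot_le_sqr ((hnorm y)%:C *: x) ((hnorm x)%:C *: y).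
rewrite rdotZl rdotZr !hnormZr ?hnorm_ge0 // !exprMn => h.
have : hnorm y * hnorm x * (hnorm x * hnorm y - rdot x y) >= 0 by nra.
by rewrite pmulr_rge0 ?mulr_gt0 // subr_ge0.
Qed.

Lemma rdot_inj x y : (forall z, rdot x z = rdot y z) -> x = y.
Proof.
move=> xy; apply/eqP; rewrite -subr_eq0; apply/eqP/rdot_eq0.
by rewrite rdotBl xy subrr.
Qed.

Lemma rdot_suml (I : Type) (r : seq I) (P : pred I) (F : I -> H) z :
  rdot (\sum_(i <- r | P i) F i) z = \sum_(i <- r | P i) rdot (F i) z.
Proof.
elim/big_rec2: _ => [|i u v _ <-]; first exact: rdot0l.
by rewrite rdotDl.
Qed.

(** The balls of the topology of [H] have radii in [R[i]], whereas all the
    estimates below are real. *)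
Lemma hilbert_complete (u : nat -> H) :
    (forall e : R, 0 < e -> exists N, forall n m, (N <= n)%N -> (N <= m)%N ->
       hnorm (u n - u m) < e) ->
  exists l, forall e : R, 0 < e -> exists N, forall n, (N <= n)%N ->
     hnorm (l - u n) < e.
Proof.
move=> ucauchy.
have /cauchy_cvgP/cvg_ex[l ul] : cauchy (u @ \oo).
  apply: cauchy_exP => e e0.
  have eE : e = (complex.Re e)%:C by rewrite RRe_real // gtr0_real.
  have [|N uN] := ucauchy (complex.Re e); first by rewrite -ltcR -eE.
  exists (u N); exists N => // n /= Nn.
  by rewrite -ball_normE /= eE norm_hnorm ltcR uN.
exists l => e e0.
have /cvgrPdist_lt/(_ e%:C) := ul; rewrite ltcR => /(_ e0)[N _ uN].
by exists N => n Nn; rewrite -ltcR -norm_hnorm; exact: uN.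
Qed.

End RealInnerProduct.

Section Riesz.
Variables (R : realType) (H : hilbertType R).
Implicit Types (x y z : H) (t : R).

(** The quadratic functional [rdot y y / 2 - f y] has a minimiser [w]: by the
    parallelogram law its minimising sequences are Cauchy. The vanishing of the
    derivative at [w] in every direction says that [w] represents [f]. *)
Lemma riesz (f : H -> R) (c : R) :
    (forall x y, f (x + y) = f x + f y) ->
    (forall t x, f (t%:C *: x) = t * f x) ->
    (forall x, f x <= c * hnorm x) ->
  exists w, forall y, rdot w y = f y.
Proof.
move=> fD fZ fc.
pose J y := rdot y y / 2 - f y.
have fN x : f (- x) = - f x.
  by rewrite -scaleN1r -(rmorph1 (real_complex R)) -rmorphN fZ mulN1r.
have Jlb y : - (c ^+ 2 / 2) <= J y.
  rewrite /J -hnorm_sqr; have := fc y; have := sqr_ge0 (hnorm y - c).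
  nra.
pose m := inf (range J).
have Jinf : has_inf (range J).
  split; first by exists (J 0), 0.
  by exists (- (c ^+ 2 / 2)) => _ [y _ <-].
have mJ y : m <= J y by apply: ge_inf; [exact: Jinf.2|exists y].
have par x y : hnorm (x - y) ^+ 2 <= 4 * (J x - m) + 4 * (J y - m).
  have := mJ ((2^-1)%:C *: (x + y)).
  rewrite /J fZ fD !(rdotZl, rdotZr) hnorm_sqr.
  by rewrite !(rdotDl, rdotDr, rdotNl, rdotNr) (rdotC y x); lra.
have /choice[u uP] (n : nat) : exists y, J y < m + n.+1%:R^-1.
  have [|_ [y _ <-] yP] := @inf_adherent _ (range J) n.+1%:R^-1 _ Jinf.
    by rewrite invr_gt0 ltr0n.
  by exists y.
have inv_le (N n : nat) : (N <= n)%N -> (n.+1%:R^-1 : R) <= N.+1%:R^-1.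
  by move=> Nn; rewrite lef_pV2 ?posrE ?ltr0n // ler_nat ltnS.
have [w uw] : exists w, forall e : R, 0 < e ->
    exists N, forall n, (N <= n)%N -> hnorm (w - u n) < e.
  apply: hilbert_complete => e e0.
  have e20 : 0 < e ^+ 2 / 8 by rewrite divr_gt0 ?exprn_gt0.
  have [N Ne] := ltr_add_invr e20; rewrite add0r in Ne.
  exists N => n k Nn Nk.
  rewrite -(ltr_pXn2r (ltn0Sn 1)) ?nnegrE ?hnorm_ge0 ?ltW //.
  apply: le_lt_trans (par _ _) _.
  move: (uP n) (uP k) (inv_le _ _ Nn) (inv_le _ _ Nk) Ne.
  set a := (n.+1%:R^-1); set b := (k.+1%:R^-1); set r := (N.+1%:R^-1).
  by lra.
have Jw : J w <= m.
  apply/ler_addgt0Pr => e e0.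
  (* [K] is a Lipschitz constant of [J] on the ball of radius 1 around [w] *)
  pose K := hnorm w + `|c| + 1.
  have K0 : 0 < K by have := hnorm_ge0 w; have := normr_ge0 c; rewrite /K; lra.
  pose d := Num.min 1 (e / 2 / K).
  have d0 : 0 < d by rewrite lt_min ltr01 !divr_gt0.
  have [N uN] := uw d d0.
  have e20 : 0 < e / 2 by rewrite divr_gt0.
  have [M Me] := ltr_add_invr e20; rewrite add0r in Me.
  pose n := maxn N M.
  have un := uN n (leq_maxl _ _).
  have Jun : J (u n) < m + e / 2.
    apply: lt_trans (uP n) _; rewrite ltrD2l; apply: le_lt_trans Me.
    by apply: inv_le; exact: leq_maxr.
  set h := w - u n in un.
  have uE : u n = w - h by rewrite /h opprB addrC subrK.
  clearbody h.
  have h0 := hnorm_ge0 h.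
  have hK : hnorm h * K <= e / 2.
    rewrite -ler_pdivlMr //; apply: le_trans (ltW un) _.
    by rewrite /d ge_min lexx orbT.
  have : J (u n) = J w - rdot w h + rdot h h / 2 + f h.
    rewrite uE /J fD fN !(rdotDl, rdotDr, rdotNl, rdotNr) (rdotC h w); lra.
  have := rdot_le w h; have := rdot_ge0 h; have := fc (- h); rewrite fN hnormN.
  have : c * hnorm h <= `|c| * hnorm h by rewrite ler_wpM2r // ler_norm.
  move: hK; rewrite /K; nra.
exists w => y.
have key t : 0 <= t * (rdot w y - f y) + t ^+ 2 * (rdot y y / 2).
  have := le_trans Jw (mJ (w + t%:C *: y)).
  rewrite /J fD fZ !(rdotDl, rdotDr, rdotZl, rdotZr) (rdotC y w); nra.
apply/eqP; rewrite -subr_eq0; apply/eqP; set b := rdot w y - f y in key *.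
pose q := rdot y y + 1.
have q0 : 0 < q by rewrite /q; have := rdot_ge0 y; lra.
(* unless [b = 0], the function of [key] takes negative values near 0 *)
have := key (- b / q); rewrite (_ : _ + _ = - (b ^+ 2) * (q^-1 - q^-2 * (rdot y y / 2)));
  last first.
  by field; rewrite gt_eqF.
have -> : q^-1 - q^-2 * (rdot y y / 2) = q^-2 * (q - rdot y y / 2).
  by field; rewrite gt_eqF.
move=> h; apply/eqP; rewrite -(sqrf_eq0 b) eq_le sqr_ge0 andbT.
have : 0 < q^-2 * (q - rdot y y / 2).
  by rewrite mulr_gt0 ?invr_gt0 ?exprn_gt0 // /q; have := rdot_ge0 y; lra.
by move: h; rewrite mulNr oppr_ge0 => h h1; move: h; rewrite pmulr_lle0.
Qed.

End Riesz.

(** * Bounded operators and the norms of matrices of operators *)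

Section BoundedOperators.
Variables (R : realType) (H : hilbertType R).
Implicit Types (x y z : H) (T S : H -> H).

Lemma bounded_operatorsP T : bounded_operators T <->
  linear T /\ exists2 c : R, 0 <= c & forall x, hnorm (T x) <= c * hnorm x.
Proof.
split=> [[Tlin Tc]|[Tlin [c c0 Tc]]]; split=> //.
- pose f : {linear H -> H} := HB.pack T (GRing.isLinear.Build _ _ _ _ T Tlin).
  have /linear_boundedP/pinfty_ex_gt0[r r0 rP] : bounded_near f (nbhs (0 : H)).
    exact/linear_bounded_continuous.
  have /complex_realP[c rE] : r \is Num.real by rewrite gtr0_real.
  exists c; first by rewrite -lecR -rE ltW.
  move=> x; have := rP x; rewrite rE /= !norm_hnorm -lecR.
  by rewrite -[(c * _)%:C]/(real_complex R (c * _)) rmorphM.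
- pose f : {linear H -> H} := HB.pack T (GRing.isLinear.Build _ _ _ _ T Tlin).
  suff : continuous f by [].
  apply/linear_bounded_continuous/linear_boundedP.
  exists c%:C; split; first by apply/complex_realP; exists c.
  move=> r cr x; rewrite /= norm_hnorm.
  apply: (@le_trans _ _ (c%:C * `|x|)); last by rewrite ler_wpM2r // ltW.
  by rewrite norm_hnorm -rmorphM lecR; exact: Tc.
Qed.

Lemma linear_add T x y : linear T -> T (x + y) = T x + T y.
Proof. by move=> Tl; rewrite -[x]scale1r Tl !scale1r. Qed.

Lemma linear_zero T : linear T -> T 0 = 0.
Proof. by move=> Tl; apply: (addrI (T 0)); rewrite -linear_add // !addr0. Qed.

Lemma linear_scale T (a : R[i]) x : linear T -> T (a *: x) = a *: T x.
Proof. by move=> Tl; rewrite -[a *: x]addr0 Tl linear_zero // addr0. Qed.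

(** Limits of operators and extensions of maps are first obtained as real forms.
    Riesz's theorem turns each [s x] into a vector depending additively on [x];
    the compatibility of [s] with complex scalars is what makes this dependence
    complex linear. *)
Lemma operator_of_form (s : H -> H -> R) (c : R) : 0 <= c ->
    (forall x y z, s (x + y) z = s x z + s y z) ->
    (forall x y z, s z (x + y) = s z x + s z y) ->
    (forall (t : R) x y, s x (t%:C *: y) = t * s x y) ->
    (forall a x y, s (a *: x) y = s x (conjc a *: y)) ->
    (forall x y, s x y <= c * ((hnorm x ^+ 2 + hnorm y ^+ 2) / 2)) ->
  exists2 T, bounded_operators T & forall x y, rdot (T x) y = s x y.
Proof.
move=> c0 sDl sDr sZr sC sb.
have sZl t x y : s (t%:C *: x) y = t * s x y by rewrite sC conjc_real sZr.
have s0r x : s x 0 = 0.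
  by rewrite -(scale0r 0) -(rmorph0 (real_complex R)) sZr mul0r.
have s0l x : s 0 x = 0.
  by rewrite -(scale0r 0) -(rmorph0 (real_complex R)) sZl mul0r.
have sb' x y : s x y <= (c * hnorm x) * hnorm y.
  have [->|x0] := eqVneq x 0; first by rewrite s0l hnorm0 mulr0 mul0r.
  have [->|y0] := eqVneq y 0; first by rewrite s0r hnorm0 mulr0.
  have hx := hnorm_gt0 x0; have hy := hnorm_gt0 y0.
  have := sb ((hnorm y)%:C *: x) ((hnorm x)%:C *: y).
  rewrite sZl sZr !hnormZr ?hnorm_ge0 // !exprMn => h.
  have : hnorm y * hnorm x * (c * hnorm x * hnorm y - s x y) >= 0 by nra.
  by rewrite pmulr_rge0 ?mulr_gt0 // subr_ge0.
have /choice[T TP] x : exists w, forall y, rdot w y = s x y.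
  by apply: (@riesz _ _ (s x) (c * hnorm x)) => // *; rewrite ?sDr ?sZr ?sb'.
exists T => //; apply/bounded_operatorsP; split.
  move=> a x y; apply: rdot_inj => z.
  by rewrite rdotDl rdotZ_conj !TP sDl sC.
exists c => // x.
have [->|Tx0] := eqVneq (T x) 0; first by rewrite hnorm0 mulr_ge0 ?hnorm_ge0.
by rewrite -(ler_pM2r (hnorm_gt0 Tx0)) -expr2 hnorm_sqr TP sb'.
Qed.

Lemma bounded_operator_space : operator_space (@bounded_operators R H).
Proof.
split=> //.
  apply/bounded_operatorsP; split; first by move=> a x y; rewrite [LHS]/= scaler0 addr0.
  by exists 0 => // x; rewrite [X in hnorm X]/= hnorm0 mul0r.
move=> a S T /bounded_operatorsP[Sl [c c0 cS]] /bounded_operatorsP[Tl [d d0 dT]].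
apply/bounded_operatorsP; split.
  move=> b x y; rewrite !fctE Sl Tl !scalerDr !scalerA (mulrC a b).
  by rewrite addrACA.
have a0 : 0 <= complex.Re `|a| by rewrite normc_def sqrtr_ge0.
exists (complex.Re `|a| * c + d); first by rewrite addr_ge0 ?mulr_ge0.
move=> x; rewrite !fctE; apply: le_trans (hnormD _ _) _.
by rewrite mulrDl lerD // hnormZ -mulrA ler_wpM2l.
Qed.

End BoundedOperators.

Section MatrixNorms.
Variables (R : realType) (H : hilbertType R) (n : nat).
Implicit Types (x y : 'I_n -> H) (A : 'M[H -> H]_n) (c : R).

Definition l2sq x : R := \sum_(i < n) hnorm (x i) ^+ 2.

Definition mxform A x y : R :=
  \sum_(i < n) \sum_(j < n) rdot (A i j (x j)) (y i).

(** The inequality [mxopnorm A <= c], in a form that is linear in [A], behaves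
    well under limits and needs no supremum. *)
Definition mxbound c A : Prop :=
  forall x y, mxform A x y <= c * ((l2sq x + l2sq y) / 2).

Lemma l2sq_ge0 x : 0 <= l2sq x.
Proof. by rewrite sumr_ge0 // => i _; exact: sqr_ge0. Qed.

Lemma l2normE x : l2norm x = Num.sqrt (l2sq x). Proof. by []. Qed.

Lemma l2norm_ge0 x : 0 <= l2norm x. Proof. exact: sqrtr_ge0. Qed.

Lemma l2norm_sqr x : l2norm x ^+ 2 = l2sq x.
Proof. by rewrite l2normE sqr_sqrtr // l2sq_ge0. Qed.

Lemma l2sqZ (t : R) x : l2sq (fun i => t%:C *: x i) = t ^+ 2 * l2sq x.
Proof.
rewrite /l2sq big_distrr; apply: eq_bigr => i _ /=.
by rewrite !hnorm_sqr rdotZl rdotZr mulrA.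
Qed.

Lemma l2sq_eq0 x : l2sq x = 0 -> forall i, x i = 0.
Proof.
move=> x0 i; apply/hnorm_eq0/eqP; rewrite -(sqrf_eq0 (hnorm _)).
by move/eqP: x0; rewrite psumr_eq0 => [/allP/(_ i)|j _]; [exact|exact: sqr_ge0].
Qed.

Lemma hnorm_le_l2sq x i : hnorm (x i) ^+ 2 <= l2sq x.
Proof.
by rewrite /l2sq (bigD1 i) //= lerDl sumr_ge0 // => j _; exact: sqr_ge0.
Qed.

Lemma mxformE A x y : mxform A x y = \sum_(i < n) rdot (mxact A x i) (y i).
Proof. by apply: eq_bigr => i _; rewrite rdot_suml. Qed.

Lemma mxbound_bounded A : (forall i j, bounded_operators (A i j)) ->
  exists2 c, 0 <= c & mxbound c A.
Proof.
move=> Ab.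
have /choice[C CP] (p : 'I_n * 'I_n) : exists c : R, 0 <= c /\
    forall z, hnorm (A p.1 p.2 z) <= c * hnorm z.
  by have /bounded_operatorsP[_ [c c0 cP]] := Ab p.1 p.2; exists c.
exists (\sum_(i < n) \sum_(j < n) C (i, j)).
  by do 2![apply: sumr_ge0 => ? _]; exact: (CP _).1.
move=> x y; rewrite /mxform mulr_suml; apply: ler_sum => i _.
rewrite mulr_suml; apply: ler_sum => j _.
have [c0 /(_ (x j)) cA] := CP (i, j).
apply: le_trans (rdot_le _ _) _.
apply: (@le_trans _ _ (C (i, j) * hnorm (x j) * hnorm (y i))).
  by rewrite ler_wpM2r ?hnorm_ge0.
rewrite -mulrA ler_wpM2l //.
have := hnorm_le_l2sq x j; have := hnorm_le_l2sq y i.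
have := sqr_ge0 (hnorm (x j) - hnorm (y i)); nra.
Qed.

(** The bound is quadratic in the pair of vectors, so it is tested on the multiples
    of [mxact A x]. *)
Lemma mxbound_act c A x : 0 <= c -> mxbound c A ->
  l2sq (mxact A x) <= c ^+ 2 * l2sq x.
Proof.
move=> c0 cA; set u := mxact A x.
have uu : mxform A x u = l2sq u.
  by rewrite mxformE; apply: eq_bigr => i _; rewrite -hnorm_sqr.
have key (t : R) : t * l2sq u <= c * ((l2sq x + t ^+ 2 * l2sq u) / 2).
  have := cA x (fun i => t%:C *: u i); rewrite l2sqZ; apply: le_trans.
  rewrite -uu !mxformE mulr_sumr; apply: ler_sum => i _.
  by rewrite rdotZr.
have [cE|cn0] := eqVneq c 0.
  by have := key 1; rewrite cE mul1r !mul0r expr0n mul0r.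
have cp : 0 < c by rewrite lt_neqAle eq_sym cn0.
(* [t = 1 / c] balances the two terms *)
have h := key c^-1.
have : c * (c^-1 * l2sq u) <=
    c * (c * ((l2sq x + c^-1 ^+ 2 * l2sq u) / 2)) by rewrite ler_pM2l.
rewrite (_ : c * (c^-1 * _) = l2sq u); last by field.
rewrite (_ : c * (c * _) = (c ^+ 2 * l2sq x + l2sq u) / 2); last by field.
by lra.
Qed.

Lemma mxbound_of_act c A : 0 <= c ->
  (forall x, l2sq (mxact A x) <= c ^+ 2 * l2sq x) -> mxbound c A.
Proof.
move=> c0 cA x y; have := cA x; set u := mxact A x => ux.
have [cE|cn0] := eqVneq c 0.
  rewrite mxformE big1 ?cE ?mul0r // => i _.
  have /l2sq_eq0/(_ i) ui : l2sq u = 0.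
    by apply/eqP; rewrite eq_le l2sq_ge0 andbT; move: ux; rewrite cE expr0n mul0r.
  by rewrite [mxact A x i]ui rdot0l.
have cp : 0 < c by rewrite lt_neqAle eq_sym cn0.
rewrite -(ler_pM2l cp).
apply: (@le_trans _ _ ((l2sq u + c ^+ 2 * l2sq y) / 2)); last by nra.
rewrite mxformE mulr_sumr -l2sqZ /l2sq -big_split /= mulr_suml.
apply: ler_sum => i _; rewrite -rdotZr; exact: rdot_le_sqr.
Qed.

Lemma mxopnorm_set_ub c A : 0 <= c -> mxbound c A ->
  ubound [set l2norm (mxact A x) | x in [set x | l2norm x <= 1]] c.
Proof.
move=> c0 cA _ [x x1 <-].
rewrite -(ler_pXn2r (ltn0Sn 1)) ?nnegrE ?l2norm_ge0 // l2norm_sqr.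
apply: le_trans (mxbound_act _ c0 cA) _.
rewrite ler_piMr ?sqr_ge0 // -l2norm_sqr expr_le1 //; exact: l2norm_ge0.
Qed.

Lemma mxopnorm_set_nonempty A :
  [set l2norm (mxact A x) | x in [set x | l2norm x <= 1]] !=set0.
Proof.
exists (l2norm (mxact A (fun=> 0))), (fun=> 0) => //=.
by rewrite l2normE /l2sq big1 ?sqrtr0 ?ler01 // => i _; rewrite hnorm0 expr0n.
Qed.

Lemma mxopnorm_ge0 A : (forall i j, bounded_operators (A i j)) -> 0 <= mxopnorm A.
Proof.
move=> /mxbound_bounded[c c0 cA].
have [r rP] := mxopnorm_set_nonempty A.
apply: le_trans (sup_upper_bound _ rP).
  by case: rP => x _ <-; exact: l2norm_ge0.
by split; [exists r|exists c; exact: mxopnorm_set_ub].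
Qed.

Lemma mxopnorm_leP c A : (forall i j, bounded_operators (A i j)) -> 0 <= c ->
  mxopnorm A <= c <-> mxbound c A.
Proof.
move=> Ab c0; split=> [Ac|cA]; last first.
  by apply: sup_le_ub; [exact: mxopnorm_set_nonempty|exact: mxopnorm_set_ub].
apply: mxbound_of_act => // x.
have [d d0 dA] := mxbound_bounded Ab.
have [x0|x0] := eqVneq (l2sq x) 0.
  by rewrite x0 mulr0; have := mxbound_act x d0 dA; rewrite x0 mulr0.
have xp : 0 < l2norm x.
  by rewrite l2normE sqrtr_gt0 lt_neqAle eq_sym x0 l2sq_ge0.
pose t := (l2norm x)^-1; have tp : 0 < t by rewrite invr_gt0.
have tx : t ^+ 2 * l2sq x = 1 by rewrite -l2norm_sqr -exprMn mulVf ?expr1n ?gt_eqF.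
pose x' := fun i => t%:C *: x i.
have x'1 : l2norm x' <= 1 by rewrite l2normE /x' l2sqZ tx sqrtr1.
have actZ : mxact A x' = fun i => t%:C *: mxact A x i.
  apply/funext => i; rewrite /mxact scaler_sumr; apply: eq_bigr => j _.
  by rewrite linear_scale //; exact: (Ab i j).1.
have : l2norm (mxact A x') <= c.
  apply: le_trans Ac; apply: sup_upper_bound; last by exists x'.
  split; first exact: mxopnorm_set_nonempty.
  by exists d; exact: mxopnorm_set_ub.
rewrite -(ler_pXn2r (ltn0Sn 1)) ?nnegrE ?l2norm_ge0 // l2norm_sqr actZ l2sqZ.
have xp2 : 0 < l2sq x by rewrite lt_neqAle eq_sym x0 l2sq_ge0.
by rewrite -(ler_pM2r xp2) mulrAC tx mul1r.
Qed.

End MatrixNorms.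

Section OperatorNorm.
Variables (R : realType) (H : hilbertType R).
Implicit Types (x y : H) (T : H -> H) (c : R).

Lemma opnorm_mxopnorm T : opnorm T = mxopnorm (const_mx T : 'M[H -> H]_1).
Proof.
have l2 (x : 'I_1 -> H) : l2norm x = hnorm (x ord0).
  by rewrite /l2norm big_ord1 sqrtr_sqr ger0_norm ?hnorm_ge0.
rewrite /opnorm /mxopnorm; congr sup; apply/seteqP; split=> _ [x /= x1 <-].
- exists (fun=> x); first by rewrite /= l2.
  by rewrite l2 /mxact big_ord1 mxE.
- exists (x ord0); first by rewrite /= -l2.
  by rewrite l2 /mxact big_ord1 mxE.
Qed.

Lemma mxbound1P c T : mxbound c (const_mx T : 'M[H -> H]_1) <->
  forall x y, rdot (T x) y <= c * ((hnorm x ^+ 2 + hnorm y ^+ 2) / 2).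
Proof.
split=> [cT x y|cT x y].
  have := cT (fun=> x) (fun=> y).
  by rewrite /mxform /l2sq !big_ord1 mxE.
by rewrite /mxform /l2sq !big_ord1 mxE; exact: cT.
Qed.

Lemma opnorm_leP c T : bounded_operators T -> 0 <= c -> opnorm T <= c <->
  forall x y, rdot (T x) y <= c * ((hnorm x ^+ 2 + hnorm y ^+ 2) / 2).
Proof.
move=> Tb c0; rewrite opnorm_mxopnorm -mxbound1P; apply: mxopnorm_leP => //.
by move=> i j; rewrite mxE.
Qed.

Lemma opnorm_ge0 T : bounded_operators T -> 0 <= opnorm T.
Proof. by move=> Tb; rewrite opnorm_mxopnorm mxopnorm_ge0 // => i j; rewrite mxE. Qed.

Lemma opnorm_eq0 T : bounded_operators T -> opnorm T = 0 -> T = 0.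
Proof.
move=> Tb T0; apply/funext => x; apply: rdot_eq0.
have /opnorm_leP : opnorm T <= 0 by rewrite T0.
move=> /(_ Tb (lexx _) x (T x)); rewrite mul0r => h.
by apply/eqP; rewrite eq_le h rdot_ge0.
Qed.

End OperatorNorm.

Section CompleteContractions.
Variables (R : realType) (H K : hilbertType R).
Variables (X : set (H -> H)) (Y : set (K -> K)).
Hypothesis (XB : X `<=` @bounded_operators R H).
Hypothesis (YB : Y `<=` @bounded_operators R K).

(** Quantifying over the bounds [c] replaces the comparison of two norms by the
    preservation of an inequality. *)
Lemma completely_contractiveP (phi : (H -> H) -> (K -> K)) :
  completely_contractive X Y phi <-> linear_map X Y phi /\
  forall n (A : 'M[H -> H]_n) c, (forall i j, X (A i j)) -> 0 <= c ->
    mxbound c A -> mxbound c (map_mx phi A).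
Proof.
split=> -[lin ctr]; split=> // n A.
- move=> c AX c0 /mxopnorm_leP Ac.
  have pB i j : bounded_operators (map_mx phi A i j).
    by rewrite mxE; apply: YB; exact: lin.1.
  apply/mxopnorm_leP => //; apply: le_trans (ctr _ _ AX) _.
  by apply: Ac => // i j; exact: XB.
- move=> AX.
  have AB i j : bounded_operators (A i j) by exact: XB.
  have pB i j : bounded_operators (map_mx phi A i j).
    by rewrite mxE; apply: YB; exact: lin.1.
  have c0 := mxopnorm_ge0 AB.
  by apply/mxopnorm_leP => //; apply: ctr => //; apply/mxopnorm_leP.
Qed.

Lemma completely_contractive_opnorm phi T : completely_contractive X Y phi ->
  X T -> opnorm (phi T) <= opnorm T.
Proof.
move=> [_ ctr] XT; rewrite !opnorm_mxopnorm.
rewrite (_ : const_mx (phi T) = map_mx phi (const_mx T)); last first.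
  by apply/matrixP => i j; rewrite !mxE.
by apply: ctr => i j; rewrite mxE.
Qed.

End CompleteContractions.

(** * A Hahn-Banach theorem for cones *)

Section HahnBanach.
Variables (R : realType) (U : lmodType R[i]).
Implicit Types (S M : set (U * R)).

(** [S (u, r)] is to be read as the requirement [g u <= r] on a functional [g].
    By [coneN] the requirements concern the vectors of a subspace; otherwise they
    could force values of [g] to be arbitrarily negative. *)
Record bounding_cone S : Prop := BoundingCone {
  cone0 : S (0, 0);
  coneD : forall u v r s, S (u, r) -> S (v, s) -> S (u + v, r + s);
  coneZ : forall t u r, 0 < t -> S (u, r) -> S (t%:C *: u, t * r);
  cone_ge0 : forall r, S (0, r) -> 0 <= r;
  coneN : forall u r, S (u, r) -> exists s, S (- u, s) }.

(** The value [t] at [u] has to lie between the numbers [- r] with [M (- u, r)]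
    and the numbers [r] with [M (u, r)]. *)
Lemma bounding_cone_extend M u : bounding_cone M -> exists t,
  bounding_cone [set p | exists v s l, [/\ M (v, s), p.1 = v + l%:C *: u &
                                         p.2 = s + l * t]].
Proof.
move=> [M0 MD MZ Mge0 MN].
pose L := [set - r | r in [set r | M (- u, r)]].
have LM l r : L l -> M (u, r) -> l <= r.
  move=> [r' Mr' <-] Mr; have := MD _ _ _ _ Mr' Mr.
  by rewrite addNr => /Mge0; rewrite addrC -[r']opprK subr_ge0 opprK.
pose t := sup L.
have tge r : M (- u, r) -> - r <= t.
  move=> Mr; apply: sup_upper_bound; last by exists r.
  split; first by exists (- r), r.
  have [r' Mr'] := MN _ _ Mr; rewrite opprK in Mr'.
  by exists r' => l Ll; exact: LM Mr'.
have tle r : M (u, r) -> t <= r.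
  move=> Mr; apply: sup_le_ub; last by move=> l Ll; exact: LM Mr.
  by have [r' Mr'] := MN _ _ Mr; exists (- r'), r'.
exists t; split => /=.
- by exists 0, 0, 0; split; rewrite // ?scale0r ?addr0 // mul0r addr0.
- move=> _ _ _ _ [v [s [l [Mv -> ->]]]] [v' [s' [l' [Mv' -> ->]]]].
  exists (v + v'), (s + s'), (l + l'); split; first exact: MD.
    by rewrite rmorphD /= scalerDl addrACA.
  by rewrite mulrDl addrACA.
- move=> a _ _ a0 [v [s [l [Mv -> ->]]]].
  exists (a%:C *: v), (a * s), (a * l); split; first exact: MZ.
    by rewrite scalerDr scalerA rmorphM.
  by rewrite mulrDr mulrA.
- move=> _ [v [s [l [Mv v0 ->]]]].
  have vE : v = - (l%:C *: u) by apply/eqP; rewrite -addr_eq0 -v0.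
  have [l0|l0|l0] := ltgtP l 0.
  + have a0 : 0 < (- l)^-1 by rewrite invr_gt0 oppr_gt0.
    have aE : (- l)^-1 * l = -1 by field; rewrite lt_eqF.
    have := MZ _ _ _ a0 Mv; rewrite vE scalerN scalerA -rmorphM aE rmorphN.
    rewrite rmorph1 scaleN1r opprK => /tle.
    by rewrite ler_pdivlMl ?oppr_gt0 // mulNr -subr_ge0 opprK.
  + have a0 : 0 < l^-1 by rewrite invr_gt0.
    have := MZ _ _ _ a0 Mv; rewrite vE scalerN scalerA -rmorphM mulVf ?gt_eqF //.
    rewrite rmorph1 scale1r => /tge.
    by rewrite -mulrN ler_pdivrMl // -subr_ge0 opprK addrC.
  + rewrite l0 mul0r addr0; apply: Mge0.
    by rewrite vE l0 rmorph0 scale0r oppr0 in Mv.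
- move=> _ _ [v [s [l [Mv -> _]]]].
  have [s' Ms'] := MN _ _ Mv.
  exists (s' - l * t), (- v), s', (- l); split => //.
    by rewrite opprD rmorphN scaleNr.
  by rewrite mulNr.
Qed.

(** By the extension lemma, a maximal bounding cone containing [S] contains
    [(u, t)] and [(- u, - t)] for some [t], for every vector [u]; this [t] is the
    value of the functional. Unions of chains of cones are again cones, which
    would not be so immediate for infima of chains of sublinear functionals. *)
Theorem hahn_banach_cone S : bounding_cone S -> exists g : U -> R,
  [/\ forall u v, g (u + v) = g u + g v,
      forall t u, g (t%:C *: u) = t * g u &
      forall u r, S (u, r) -> g u <= r].
Proof.
move=> Scone.
have [F FP Ftot|A [Acone Amax]] :=
    @Zorn_bigcup (U * R)%type [set A | bounding_cone (S `|` A)].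
  (* two elements of the union lie in a single member of the chain; the empty
     set stands for the elements of S when the chain is empty *)
  have two p q : (S `|` \bigcup_(X in F) X) p -> (S `|` \bigcup_(X in F) X) q ->
      exists X, [/\ bounding_cone (S `|` X), (S `|` X) p, (S `|` X) q &
                    S `|` X `<=` S `|` \bigcup_(X in F) X].
    have sub X : F X -> S `|` X `<=` S `|` \bigcup_(X in F) X.
      by move=> FX; apply: setUS; exact: bigcup_sup.
    case=> [Sp|[X FX Xp]]; case=> [Sq|[Y FY Yq]].
    - exists set0; rewrite setU0; split => //; exact: subsetUl.
    - by exists Y; split; [exact: FP|left|right|exact: sub].
    - by exists X; split; [exact: FP|right|left|exact: sub].
    - have [XY|YX] := Ftot X Y FX FY.
        by exists Y; split; [exact: FP|right; exact: XY|right|exact: sub].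
      by exists X; split; [exact: FP|right|right; exact: YX|exact: sub].
  split.
  - by left; exact: cone0.
  - move=> u v r s p q; have [X [Xc Xp Xq]] := two _ _ p q; apply.
    exact: (coneD Xc).
  - move=> t u r t0 p; have [X [Xc Xp _]] := two _ _ p p; apply.
    exact: (coneZ Xc).
  - move=> r p; have [X [Xc Xp _ _]] := two _ _ p p; exact: (cone_ge0 Xc).
  - move=> u r p; have [X [Xc Xp _ sub]] := two _ _ p p.
    by have [s Xs] := coneN Xc Xp; exists s; exact: sub.
set M := S `|` A in Acone.
have /choice[g gP] u : exists t, M (u, t) /\ M (- u, - t).
  have [t] := bounding_cone_extend u Acone; set M' := [set p | _] => M'cone.
  exists t.
  have MM' : M `<=` M'.
    move=> [v s] Mv; exists v, s, 0.
    by rewrite /= rmorph0 scale0r addr0 mul0r addr0.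
  have M'A : M' `<=` A.
    apply: contrapT => nM'A; apply: (Amax M'); last first.
      rewrite /= (_ : S `|` M' = M') //; apply/setUidPr => p Sp.
      by apply: MM'; left.
    split => // p Ap; apply: MM'; right; exact: Ap.
  have [M0 _ _ _ _] := Acone.
  split; right; apply: M'A.
    exists 0, 0, 1; split; first exact: M0.
      by rewrite /= rmorph1 scale1r add0r.
    by rewrite /= mul1r add0r.
  exists 0, 0, (-1); split; first exact: M0.
    by rewrite /= rmorphN rmorph1 scaleN1r add0r.
  by rewrite /= mulN1r add0r.
have gle u r : M (u, r) -> g u <= r.
  move=> Mu; have := coneD Acone Mu (gP u).2; rewrite subrr => /(cone_ge0 Acone).
  by rewrite subr_ge0.
have gge u r : M (- u, - r) -> r <= g u.
  move=> Mu; have := coneD Acone (gP u).1 Mu; rewrite subrr => /(cone_ge0 Acone).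
  by rewrite subr_ge0.
have gD u v : g (u + v) = g u + g v.
  apply/eqP; rewrite eq_le gle ?gge //.
    by rewrite !opprD; apply: (coneD Acone); exact: (gP _).2.
  by apply: (coneD Acone); exact: (gP _).1.
have g0 : g 0 = 0 by apply: (addrI (g 0)); rewrite -gD !addr0.
have gN u : g (- u) = - g u by apply/eqP; rewrite -addr_eq0 -gD addNr g0.
have gZ t u : 0 < t -> g (t%:C *: u) = t * g u.
  move=> t0; apply/eqP; rewrite eq_le gle ?gge //.
    by rewrite -scalerN -mulrN; apply: (coneZ Acone) => //; exact: (gP _).2.
  by apply: (coneZ Acone) => //; exact: (gP _).1.
exists g; split=> // [t u|u r Su]; last by apply: gle; left.
have [t0|t0|->] := ltgtP t 0; last 2 first.
- exact: gZ.
- by rewrite rmorph0 scale0r g0 mul0r.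
- have := gZ (- t) u; rewrite oppr_gt0 => /(_ t0).
  by rewrite rmorphN scaleNr gN mulNr => /oppr_inj.
Qed.

End HahnBanach.

(** * Sums over matrices of a trilinear map *)

Section Trilinear.
Variables (R : realType) (E X U : lmodType R[i]).
Implicit Types (Z : set E) (b : E -> X -> X -> U).

(** Linear in the first two arguments and conjugate linear in the third one, as
    the map sending [T], [x], [y] to the inner product of [T x] and [y]. *)
Record trilinear Z b : Prop := Trilinear {
  trilinear1 : forall a S T x y, Z S -> Z T ->
    b (a *: S + T) x y = a *: b S x y + b T x y;
  trilinear2 : forall a T x x' y, Z T ->
    b T (a *: x + x') y = a *: b T x y + b T x' y;
  trilinear3 : forall a T x y y', Z T ->
    b T x (a *: y + y') = conjc a *: b T x y + b T x y' }.

Definition tsum b n (z : 'M[E]_n) (x y : 'I_n -> X) : U :=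
  \sum_(i < n) \sum_(j < n) b (z i j) (x j) (y i).

Definition linear_subset Z :=
  Z 0 /\ forall a S T, Z S -> Z T -> Z (a *: S + T).

Variables (Z : set E) (b : E -> X -> X -> U).
Hypotheses (Zlin : linear_subset Z) (bt : trilinear Z b).

Lemma linear_subset_scale a T : Z T -> Z (a *: T).
Proof. by move=> ZT; have := Zlin.2 a T 0 ZT Zlin.1; rewrite addr0. Qed.

Lemma linear_subset_sum (I : finType) (P : pred I) (F : I -> E) :
  (forall i, P i -> Z (F i)) -> Z (\sum_(i | P i) F i).
Proof.
move=> ZF; elim/big_ind: _ => [|S T ZS ZT|//]; first exact: Zlin.1.
by have := Zlin.2 1 S T ZS ZT; rewrite scale1r.
Qed.

Lemma trilinear01 x y : b 0 x y = 0.
Proof.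
have := trilinear1 bt (-1) x y Zlin.1 Zlin.1.
by rewrite scaler0 addr0 scaleN1r addNr.
Qed.

Lemma trilinear02 T y : Z T -> b T 0 y = 0.
Proof.
move=> ZT; have := trilinear2 bt (-1) 0 0 y ZT.
by rewrite scaler0 addr0 scaleN1r addNr.
Qed.

Lemma trilinear03 T x : Z T -> b T x 0 = 0.
Proof.
move=> ZT; have := trilinear3 bt (-1) x 0 0 ZT.
by rewrite scaler0 addr0 rmorphN rmorph1 scaleN1r addNr.
Qed.

Lemma trilinearZ1 a T x y : Z T -> b (a *: T) x y = a *: b T x y.
Proof.
move=> ZT; rewrite -[a *: T]addr0 (trilinear1 bt) ?trilinear01 ?addr0 //.
exact: Zlin.1.
Qed.

Lemma trilinearZ2 a T x y : Z T -> b T (a *: x) y = a *: b T x y.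
Proof.
by move=> ZT; rewrite -[a *: x]addr0 (trilinear2 bt) ?trilinear02 ?addr0.
Qed.

Lemma trilinearZ3 a T x y : Z T -> b T x (a *: y) = conjc a *: b T x y.
Proof.
by move=> ZT; rewrite -[a *: y]addr0 (trilinear3 bt) ?trilinear03 ?addr0.
Qed.

Lemma trilinear_sum1 (I : finType) (F : I -> E) x y : (forall i, Z (F i)) ->
  b (\sum_i F i) x y = \sum_i b (F i) x y.
Proof.
move=> ZF; suff [] : Z (\sum_i F i) /\ b (\sum_i F i) x y = \sum_i b (F i) x y by [].
elim/big_rec2: _ => [|i u T _ [ZT <-]].
  by split; [exact: Zlin.1|exact: trilinear01].
have := Zlin.2 1 _ _ (ZF i) ZT; rewrite scale1r => ZiT; split=> //.
by have := trilinear1 bt 1 x y (ZF i) ZT; rewrite !scale1r.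
Qed.

Lemma trilinear_sum2 (I : finType) T (F : I -> X) y : Z T ->
  b T (\sum_i F i) y = \sum_i b T (F i) y.
Proof.
move=> ZT; elim/big_rec2: _ => [|i u v _ <-]; first exact: trilinear02.
by have := trilinear2 bt 1 (F i) v y ZT; rewrite !scale1r.
Qed.

Lemma trilinear_sum3 (I : finType) T (F : I -> X) x : Z T ->
  b T x (\sum_i F i) = \sum_i b T x (F i).
Proof.
move=> ZT; elim/big_rec2: _ => [|i u v _ <-]; first exact: trilinear03.
by have := trilinear3 bt 1 x (F i) v ZT; rewrite rmorph1 !scale1r.
Qed.

Lemma tsumZ1 a n (z : 'M[E]_n) x y : (forall i j, Z (z i j)) ->
  tsum b (map_mx ( *:%R a) z) x y = a *: tsum b z x y.
Proof.
move=> Zz; rewrite /tsum scaler_sumr; apply: eq_bigr => i _.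
by rewrite scaler_sumr; apply: eq_bigr => j _; rewrite mxE trilinearZ1.
Qed.

Lemma tsumZ2 a n (z : 'M[E]_n) x y : (forall i j, Z (z i j)) ->
  tsum b z (fun i => a *: x i) y = a *: tsum b z x y.
Proof.
move=> Zz; rewrite /tsum scaler_sumr; apply: eq_bigr => i _.
by rewrite scaler_sumr; apply: eq_bigr => j _; rewrite trilinearZ2.
Qed.

Lemma tsumZ3 a n (z : 'M[E]_n) x y : (forall i j, Z (z i j)) ->
  tsum b z x (fun i => a *: y i) = conjc a *: tsum b z x y.
Proof.
move=> Zz; rewrite /tsum scaler_sumr; apply: eq_bigr => i _.
by rewrite scaler_sumr; apply: eq_bigr => j _; rewrite trilinearZ3.
Qed.

End Trilinear.

Section Mixing.
Variables (R : realType).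

Definition mix (X : lmodType R[i]) n (P : 'M[R[i]]_n) (x : 'I_n -> X) :
  'I_n -> X :=
  fun i => \sum_(k < n) P i k *: x k.

Lemma mix_mul (X : lmodType R[i]) n (P Q : 'M[R[i]]_n) (x : 'I_n -> X) :
  mix P (mix Q x) = mix (P *m Q) x.
Proof.
apply/funext => i; rewrite /mix.
under eq_bigr do rewrite scaler_sumr.
rewrite exchange_big; apply: eq_bigr => k _.
by rewrite mxE scaler_suml; apply: eq_bigr => j _; rewrite scalerA.
Qed.

Lemma mix1 (X : lmodType R[i]) n (x : 'I_n -> X) : mix 1%:M x = x.
Proof.
apply/funext => i; rewrite /mix (bigD1 i) //= mxE eqxx scale1r big1 ?addr0 //.
by move=> k /negPf ki; rewrite mxE eq_sym ki scale0r.
Qed.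

(** The product of the adjoint of [Q], of [z] and of [P]; the entries of [z] lie in
    a mere module. *)
Definition sandwich (E : lmodType R[i]) n (P Q : 'M[R[i]]_n) (z : 'M[E]_n) :
  'M[E]_n :=
  \matrix_(l, k) \sum_(p : 'I_n * 'I_n) (P p.2 k * conjc (Q p.1 l)) *: z p.1 p.2.

Lemma sandwich_in (E : lmodType R[i]) (Z : set E) n P Q (z : 'M[E]_n) :
  linear_subset Z -> (forall i j, Z (z i j)) ->
  forall i j, Z (sandwich P Q z i j).
Proof.
move=> Zlin Zz i j; rewrite mxE; apply: linear_subset_sum => // p _.
exact: linear_subset_scale.
Qed.

Lemma tsum_sandwich (E X U : lmodType R[i]) (Z : set E)
    (b : E -> X -> X -> U) n (P Q : 'M[R[i]]_n) (z : 'M[E]_n) x y :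
  linear_subset Z -> trilinear Z b -> (forall i j, Z (z i j)) ->
  tsum b (sandwich P Q z) x y = tsum b z (mix P x) (mix Q y).
Proof.
move=> Zlin bt Zz; rewrite /tsum !pair_bigA /=.
transitivity (\sum_(q : 'I_n * 'I_n) \sum_(p : 'I_n * 'I_n)
    (P p.2 q.2 * conjc (Q p.1 q.1)) *: b (z p.1 p.2) (x q.2) (y q.1)).
  apply: eq_bigr => q _.
  rewrite mxE (trilinear_sum1 Zlin bt) => [|p]; last exact: linear_subset_scale.
  by apply: eq_bigr => p _; rewrite (trilinearZ1 Zlin bt).
rewrite exchange_big; apply: eq_bigr => p _ /=.
rewrite -(pair_bigA _ (fun l k => (P p.2 k * conjc (Q p.1 l)) *:
  b (z p.1 p.2) (x k) (y l))) /= /mix (trilinear_sum3 bt) //.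
apply: eq_bigr => l _; rewrite (trilinearZ3 bt) // (trilinear_sum2 bt) //.
rewrite scaler_sumr; apply: eq_bigr => k _.
by rewrite (trilinearZ2 bt) // scalerA mulrC.
Qed.

End Mixing.

(** * Gram matrices and the orthogonal reduction of tensors *)

Section Gram.
Variables (R : realType) (H : hilbertType R).

Lemma operator_space_linear (X : set (H -> H)) : operator_space X -> linear_subset X.
Proof. by case. Qed.

Lemma linear_bounded_operators : linear_subset (@bounded_operators R H).
Proof. exact/operator_space_linear/bounded_operator_space. Qed.

Lemma innerDl (x y z : H) : inner (x + y) z = inner x z + inner y z.
Proof. by rewrite linearDl. Qed.

Lemma innerDr (x y z : H) : inner z (x + y) = inner z x + inner z y.
Proof. by rewrite linearDr. Qed.

Lemma inner0r (x : H) : inner x 0 = 0.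
Proof. by rewrite linear0r. Qed.

Lemma inner0l (x : H) : inner 0 x = 0.
Proof. by rewrite linear0l. Qed.

Lemma inner_self (x : H) : inner x x = (hnorm x ^+ 2)%:C.
Proof. by rewrite inner_norm norm_hnorm -rmorphXn. Qed.

Lemma inner_suml (I : finType) (F : I -> H) y :
  inner (\sum_i F i) y = \sum_i inner (F i) y.
Proof.
elim/big_rec2: _ => [|i u v _ <-]; first exact: inner0l.
by rewrite innerDl.
Qed.

Lemma inner_sumr (I : finType) (F : I -> H) y :
  inner y (\sum_i F i) = \sum_i inner y (F i).
Proof.
elim/big_rec2: _ => [|i u v _ <-]; first exact: inner0r.
by rewrite innerDr.
Qed.

Definition gram n (x : 'I_n -> H) : 'M[R[i]]_n := \matrix_(i, j) inner (x i) (x j).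

Definition adj n (P : 'M[R[i]]_n) : 'M[R[i]]_n := map_mx conjc P^T.

Lemma gram_mix n (P : 'M[R[i]]_n) (x : 'I_n -> H) :
  gram (mix P x) = P *m gram x *m adj P.
Proof.
apply/matrixP => i j; rewrite !mxE /mix inner_sumr; apply: eq_bigr => l _.
rewrite !mxE innerZr mulrC inner_suml; congr (_ * _).
by apply: eq_bigr => k _; rewrite mxE innerZl.
Qed.

Lemma gram_trace n (x : 'I_n -> H) : \tr (gram x) = (l2sq x)%:C.
Proof.
rewrite -[(l2sq x)%:C]/(real_complex R (l2sq x)) rmorph_sum.
by apply: eq_bigr => i _; rewrite mxE inner_self.
Qed.

(** Both sides are traces of Gram matrices, and traces are cyclic. *)
Lemma l2sq_mix n (P : 'M[R[i]]_n) (x : 'I_n -> H) : adj P *m P = 1%:M ->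
  l2sq (mix P x) = l2sq x.
Proof.
move=> PP; apply: complexI; rewrite -!gram_trace gram_mix.
by rewrite mxtrace_mulC mulmxA PP mul1mx.
Qed.

(** A Gram matrix is Hermitian: the spectral theorem applies. *)
Lemma gram_diagonalization n (x : 'I_n -> H) : exists P : 'M[R[i]]_n,
  [/\ P *m adj P = 1%:M, adj P *m P = 1%:M &
      forall i j, i != j -> inner (mix P x i) (mix P x j) = 0].
Proof.
have adjE (M : 'M[R[i]]_n) : map_mx Num.conj M^T = adj M by [].
have Gn : gram x \is normalmx.
  apply/normalmxP; rewrite adjE.
  suff -> : adj (gram x) = gram x by [].
  by apply/matrixP => i j; rewrite !mxE -innerC.
have Pu := spectral_unitarymx (gram x).
have /orthomx_spectralP := Gn.
set P := spectralmx (gram x) in Pu *; set D := spectral_diag _ => GE.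
have P1 : P *m adj P = 1%:M by apply/unitarymxP.
have P2 : adj P *m P = 1%:M by exact: mulmx1C.
exists P; split=> // i j ij.
have -> : inner (mix P x i) (mix P x j) = gram (mix P x) i j by rewrite mxE.
rewrite gram_mix GE mulmxA mulmxA mulmxV ?unitarymx_unit //.
rewrite mul1mx -mulmxA P1 mulmx1.
by rewrite mxE (negPf ij) mulr0n.
Qed.

Lemma trilinear_inner (K : hilbertType R) (Z : set (K -> K))
    (phi : (K -> K) -> (H -> H)) :
  (forall T, Z T -> bounded_operators (phi T)) ->
  (forall (a : R[i]) S T, Z S -> Z T ->
     phi (a *: S + T) = a *: phi S + phi T) ->
  trilinear Z (fun T x y => inner (phi T x) y : R[i]^o).
Proof.
move=> phiB philin; split.
- by move=> a S T x y ZS ZT; rewrite philin // innerDl innerZl.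
- move=> a T x x' y ZT; have [Tl _] := phiB _ ZT.
  by rewrite Tl innerDl innerZl.
- by move=> a T x y y' ZT; rewrite innerDr innerZr.
Qed.

End Gram.

Section RealPart.
Variable R : realType.

Lemma ReD (u v : R[i]) : complex.Re (u + v) = complex.Re u + complex.Re v.
Proof. by case: u; case: v. Qed.

Lemma ReZ t (u : R[i]) : complex.Re (t%:C * u) = t * complex.Re u.
Proof. by case: u => a b /=; rewrite mul0r subr0. Qed.

End RealPart.

Section Reduction.
Variables (R : realType) (K : hilbertType R).

Definition inner_form (H : hilbertType R) (T : H -> H) (x y : H) : R[i]^o :=
  inner (T x) y.

Lemma mxform_tsum (H : hilbertType R) n (A : 'M[H -> H]_n) x y :
  mxform A x y = complex.Re (tsum (@inner_form H) A x y).
Proof.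
by rewrite /tsum raddf_sum; apply: eq_bigr => i _; rewrite raddf_sum.
Qed.

Lemma trilinear_inner_form : trilinear (@bounded_operators R K) (@inner_form K).
Proof. exact: (@trilinear_inner R K K (@bounded_operators R K) id). Qed.

Lemma mxbound_sandwich n (P Q : 'M[R[i]]_n) (z : 'M[K -> K]_n) c :
  (forall i j, bounded_operators (z i j)) ->
  adj P *m P = 1%:M -> adj Q *m Q = 1%:M ->
  mxbound c z -> mxbound c (sandwich P Q z).
Proof.
move=> zB PP QQ zc x y.
rewrite mxform_tsum.
rewrite (tsum_sandwich _ _ _ _ (linear_bounded_operators K) trilinear_inner_form) //.
by rewrite -mxform_tsum -(l2sq_mix x PP) -(l2sq_mix y QQ); exact: zc.
Qed.

Definition mxmask n (p q : pred 'I_n) (z : 'M[K -> K]_n) : 'M[K -> K]_n :=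
  \matrix_(i, j) if p j && q i then z i j else 0.

Lemma mxbound_mask n (p q : pred 'I_n) (z : 'M[K -> K]_n) c :
  (forall i j, bounded_operators (z i j)) -> 0 <= c ->
  mxbound c z -> mxbound c (mxmask p q z).
Proof.
move=> zB c0 zc x y.
pose m (r : pred 'I_n) (u : 'I_n -> K) i := if r i then u i else 0.
have mle r u : l2sq (m r u) <= l2sq u.
  apply: ler_sum => i _; rewrite /m; case: ifP => // _.
  by rewrite hnorm0 expr0n; exact: sqr_ge0.
apply: (@le_trans _ _ (mxform z (m p x) (m q y))).
  rewrite /mxform le_eqVlt; apply/orP; left; apply/eqP.
  apply: eq_bigr => i _; apply: eq_bigr => j _; rewrite mxE /m.
  have z0 := linear_zero (zB i j).1.
  by case: (p j); case: (q i) => //=; rewrite ?z0 ?rdot0r ?rdot0l.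
apply: le_trans (zc _ _) _; rewrite ler_wpM2l // ler_pM2r ?invr_gt0 //.
by rewrite lerD.
Qed.

(** The elementary tensor [T x y] realised as a function: the tensor product of
    [B(K)], [H] and the conjugate of [H] embeds into the functions of two vectors
    with values in the endofunctions of [K], so that no quotient is needed. *)
Definition elem (H : hilbertType R) (T : K -> K) (x y : H) : H -> H -> K -> K :=
  fun xi eta => (inner x xi * inner eta y) *: T.

Lemma trilinear_elem (H : hilbertType R) : trilinear setT (@elem H).
Proof.
split=> [a S T x y _ _|a T x x' y _|a T x y y' _]; rewrite /elem.
- apply/funext => xi; apply/funext => eta; apply/funext => v.
  by rewrite !fctE scalerDr !scalerA mulrC.
- apply/funext => xi; apply/funext => eta; apply/funext => v.
  by rewrite !fctE innerDl innerZl scalerA mulrDl scalerDl mulrA.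
- apply/funext => xi; apply/funext => eta; apply/funext => v.
  by rewrite !fctE innerDr innerZr scalerA mulrDr scalerDl mulrCA.
Qed.

Lemma tsum_elemE (H : hilbertType R) n (z : 'M[K -> K]_n) (x y : 'I_n -> H) xi eta :
  tsum (@elem H) z x y xi eta =
  \sum_(i < n) \sum_(j < n) (inner (x j) xi * inner eta (y i)) *: z i j.
Proof.
have app (F : 'I_n -> H -> H -> K -> K) : (\sum_i F i) xi eta = \sum_i F i xi eta.
  by elim/big_rec2: _ => // i u v _ <-.
by rewrite /tsum app; apply: eq_bigr => i _; rewrite app.
Qed.

(** Every tensor has a representation of the same size with orthogonal vectors:
    diagonalise the Gram matrices of the two families of vectors by unitaries and
    let the unitaries act on the matrix instead. For such a representation the
    entries of the matrix can be read off from the tensor. *)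
Lemma orthogonal_reduction (H : hilbertType R) n (z : 'M[K -> K]_n)
    (x y : 'I_n -> H) :
    (forall i j, bounded_operators (z i j)) ->
  exists (z' : 'M[K -> K]_n) (x' y' : 'I_n -> H),
  [/\ l2sq x' = l2sq x /\ l2sq y' = l2sq y,
      forall c, 0 <= c -> mxbound c z -> mxbound c z',
      forall i j, z' i j = 0 \/
        exists xi eta, z' i j = tsum (@elem H) z x y xi eta &
      forall (U : lmodType R[i]) (Z : set (K -> K)) (b : (K -> K) -> H -> H -> U),
        linear_subset Z -> trilinear Z b -> (forall i j, Z (z i j)) ->
        tsum b z' x' y' = tsum b z x y].
Proof.
move=> zB.
have [P [P1 P2 Porth]] := gram_diagonalization x.
have [Q [Q1 Q2 Qorth]] := gram_diagonalization y.
have adjK (M : 'M[R[i]]_n) : adj (adj M) = M.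
  by apply/matrixP => i j; rewrite !mxE conjcK.
set x' := mix P x in Porth *; set y' := mix Q y in Qorth *.
have xE : mix (adj P) x' = x by rewrite mix_mul P2 mix1.
have yE : mix (adj Q) y' = y by rewrite mix_mul Q2 mix1.
pose w := sandwich (adj P) (adj Q) z.
have wB i j : bounded_operators (w i j).
  by apply: sandwich_in => //; exact: linear_bounded_operators.
(* rows and columns that meet a zero vector carry no information: they are
   replaced by zero *)
pose p := fun j => x' j != 0; pose q := fun i => y' i != 0.
have tE (U : lmodType R[i]) (Z : set (K -> K)) (b : (K -> K) -> H -> H -> U) :
    linear_subset Z -> trilinear Z b -> (forall i j, Z (z i j)) ->
    tsum b w x' y' = tsum b z x y.
  by move=> Zl bt Zz; rewrite (tsum_sandwich _ _ _ _ Zl bt) // xE yE.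
exists (mxmask p q w), x', y'; split.
- by rewrite !l2sq_mix.
- move=> c c0 zc; apply: mxbound_mask => //.
  by apply: mxbound_sandwich => //; rewrite adjK.
- move=> i j; rewrite mxE; case: ifP => [/andP[pj qi]|_]; last by left.
  (* evaluating at the dual vectors isolates the entry [w i j] *)
  right; exists ((hnorm (x' j) ^- 2)%:C *: x' j).
  exists ((hnorm (y' i) ^- 2)%:C *: y' i).
  have ET : linear_subset [set: K -> K] by [].
  rewrite -(tE _ _ _ ET (trilinear_elem H)) // tsum_elemE.
  have nz (v : H) : v != 0 -> (hnorm v ^- 2)%:C * (hnorm v ^+ 2)%:C = 1.
    move=> v0; rewrite -rmorphM mulVf ?rmorph1 // sqrf_eq0.
    by apply: contra v0 => /eqP/hnorm_eq0 ->.
  rewrite (bigD1 i) //= (bigD1 j) //= !innerZr innerZl !inner_self conjc_real.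
  rewrite !nz // mulr1 scale1r big1 => [|k kj]; last first.
    by rewrite innerZr Porth // mulr0 mul0r scale0r.
  rewrite addr0 big1 ?addr0 // => k ki; rewrite big1 // => l _.
  by rewrite [X in _ * X]innerZl Qorth 1?eq_sym // !mulr0 scale0r.
- move=> U Z b Zl bt Zz; rewrite -(tE U Z b Zl bt Zz).
  have Zw := sandwich_in (adj P) (adj Q) Zl Zz.
  apply: eq_bigr => i _; apply: eq_bigr => j _; rewrite mxE.
  case: ifP => // /negbT; rewrite (trilinear01 Zl bt) negb_and /p /q !negbK.
  case/orP => /eqP ->.
    by rewrite (trilinear02 bt) //; exact: Zw.
  by rewrite (trilinear03 bt) //; exact: Zw.
Qed.

End Reduction.

(** * Wittstock's extension theorem *)

Section BlockSums.
Variables (R : realType).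

Definition fcat (X : Type) n m (x : 'I_n -> X) (y : 'I_m -> X) : 'I_(n + m) -> X :=
  fun i => match fintype.split i with inl j => x j | inr j => y j end.

Lemma fcatl (X : Type) n m (x : 'I_n -> X) (y : 'I_m -> X) i :
  fcat x y (lshift m i) = x i.
Proof.
rewrite /fcat; case: split_ordP => j => [/lshift_inj ->|/eqP] //.
by rewrite eq_lrshift.
Qed.

Lemma fcatr (X : Type) n m (x : 'I_n -> X) (y : 'I_m -> X) i :
  fcat x y (rshift n i) = y i.
Proof.
rewrite /fcat; case: split_ordP => j => [/eqP|/rshift_inj ->] //.
by rewrite eq_rlshift.
Qed.

Lemma block_in (E : lmodType R[i]) (Z : set E) n m (z : 'M[E]_n) (w : 'M[E]_m) :
  Z 0 -> (forall i j, Z (z i j)) -> (forall i j, Z (w i j)) ->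
  forall i j, Z (block_mx z 0 0 w i j).
Proof.
move=> Z0 Zz Zw i j.
case: (split_ordP i) => i' ->; case: (split_ordP j) => j' ->.
- by rewrite block_mxEul.
- by rewrite block_mxEur mxE.
- by rewrite block_mxEdl mxE.
- by rewrite block_mxEdr.
Qed.

Lemma tsum_block (E X U : lmodType R[i]) (b : E -> X -> X -> U) n m
    (z : 'M[E]_n) (w : 'M[E]_m) x y x' y' :
  (forall u v, b 0 u v = 0) ->
  tsum b (block_mx z 0 0 w) (fcat x x') (fcat y y') =
  tsum b z x y + tsum b w x' y'.
Proof.
move=> b0; rewrite /tsum big_split_ord; congr (_ + _); apply: eq_bigr => i _;
  rewrite big_split_ord /=.
- rewrite [X in _ + X]big1 ?addr0 => [|j _].
    by apply: eq_bigr => j _; rewrite block_mxEul !fcatl.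
  by rewrite block_mxEur mxE b0.
- rewrite big1 ?add0r => [|j _].
    by apply: eq_bigr => j _; rewrite block_mxEdr !fcatr.
  by rewrite block_mxEdl mxE b0.
Qed.

Lemma l2sq_fcat (H : hilbertType R) n m (x : 'I_n -> H) (y : 'I_m -> H) :
  l2sq (fcat x y) = l2sq x + l2sq y.
Proof.
rewrite /l2sq big_split_ord; congr (_ + _); apply: eq_bigr => i _.
  by rewrite fcatl.
by rewrite fcatr.
Qed.

Lemma mxbound_block (K : hilbertType R) n m (z : 'M[K -> K]_n) (w : 'M[K -> K]_m) c :
  mxbound c z -> mxbound c w -> mxbound c (block_mx z 0 0 w).
Proof.
move=> zc wc x y.
have fE (k : 'I_(n + m) -> K) :
    k = fcat (fun i => k (lshift m i)) (fun i => k (rshift n i)).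
  by apply/funext => i; case: (split_ordP i) => j ->; rewrite ?fcatl ?fcatr.
rewrite mxform_tsum (fE x) (fE y) tsum_block => [|u v]; last exact: inner0l.
rewrite ReD -!mxform_tsum !l2sq_fcat.
by apply: le_trans (lerD (zc _ _) (wc _ _)) _; lra.
Qed.

Lemma mxbound_scale (K : hilbertType R) n (z : 'M[K -> K]_n) c t : 0 <= t ->
  (forall i j, bounded_operators (z i j)) -> mxbound c z ->
  mxbound (t * c) (map_mx ( *:%R t%:C) z).
Proof.
move=> t0 zB zc x y.
rewrite mxform_tsum.
rewrite (tsumZ1 (linear_bounded_operators K) (trilinear_inner_form K)) //.
rewrite [complex.Re _]ReZ -mxform_tsum -mulrA ler_wpM2l //.
Qed.

End BlockSums.

Section Wittstock.
Variables (R : realType) (K H : hilbertType R) (Z1 Z2 : set (K -> K)).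
Hypotheses (Z1s : operator_space Z1) (Z2s : operator_space Z2) (Z12 : Z1 `<=` Z2).
Variable phi : (K -> K) -> (H -> H).
Hypothesis phicc : completely_contractive Z1 (@bounded_operators R H) phi.

Let Z1B : Z1 `<=` @bounded_operators R K. Proof. by case: Z1s. Qed.
Let Z2B : Z2 `<=` @bounded_operators R K. Proof. by case: Z2s. Qed.
Let Z1lin : linear_subset Z1. Proof. exact: operator_space_linear. Qed.
Let Z2lin : linear_subset Z2. Proof. exact: operator_space_linear. Qed.

Let el : (K -> K) -> H -> H -> (H -> H -> K -> K) := @elem R K H.
Let F : (K -> K) -> H -> H -> R[i]^o := fun T x y => inner (phi T x) y.

Let el_tri (Z : set (K -> K)) : trilinear Z el.
Proof.
have [h1 h2 h3] := @trilinear_elem R K H.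
by split=> *; [exact: h1|exact: h2|exact: h3].
Qed.

Let F_tri : trilinear Z1 F.
Proof. by have [[phiB philin] _] := phicc; exact: trilinear_inner. Qed.

(** The requirements [g u <= r] on the functional that encodes an extension: it is
    bounded on contractive matrices over [Z2], and it is given by [phi] on [Z1]. *)
Definition wittstock_cone : set ((H -> H -> K -> K) * R) := [set p |
  exists n (z : 'M[K -> K]_n) (x y : 'I_n -> H)
         m (w : 'M[K -> K]_m) (a b : 'I_m -> H),
  [/\ (forall i j, Z2 (z i j)) /\ mxbound 1 z, forall i j, Z1 (w i j),
      p.1 = tsum el z x y + tsum el w a b &
      p.2 = (l2sq x + l2sq y) / 2 + complex.Re (tsum F w a b)]].

(** [phi] does not depend on the representation of a tensor over [Z1], and reducing
    a contractive representation over [Z2] to orthogonal vectors moves it into [Z1]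
    without loss of norm; there [phi] is completely contractive. *)
Lemma wittstock_consistent n (z : 'M[K -> K]_n) (x y : 'I_n -> H)
    m (w : 'M[K -> K]_m) (a b : 'I_m -> H) :
  (forall i j, Z2 (z i j)) -> mxbound 1 z -> (forall i j, Z1 (w i j)) ->
  tsum el z x y + tsum el w a b = 0 ->
  0 <= (l2sq x + l2sq y) / 2 + complex.Re (tsum F w a b).
Proof.
move=> Z2z z1 Z1w sum0.
have zB i j : bounded_operators (z i j) by apply: Z2B.
have [z' [x' [y' [[xx yy] z'1 z'E z't]]]] := orthogonal_reduction x y zB.
have Z1z' i j : Z1 (z' i j).
  have [->|[xi [eta ->]]] := z'E i j; first exact: Z1lin.1.
  have -> : tsum (@elem R K H) z x y = - tsum el w a b.
    by apply/eqP; rewrite -addr_eq0 sum0.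
  have -> : (- tsum el w a b) xi eta = - (tsum el w a b xi eta) by [].
  rewrite -scaleN1r; apply: linear_subset_scale => //.
  rewrite tsum_elemE; do 2![apply: linear_subset_sum => // ? _].
  exact: linear_subset_scale.
have sum0' : tsum el z' x' y' + tsum el w a b = 0.
  by rewrite (z't _ _ _ Z2lin (el_tri Z2)) // sum0.
(* the reduced form of a representation of 0 has zero entries *)
have F0 : tsum F z' x' y' + tsum F w a b = 0.
  pose v := block_mx z' 0 0 w; pose p := fcat x' a; pose q := fcat y' b.
  have Z1v i j : Z1 (v i j) by apply: block_in => //; exact: Z1lin.1.
  have vB i j : bounded_operators (v i j) by exact: Z1B.
  have [v' [p' [q' [_ _ v'E v't]]]] := orthogonal_reduction p q vB.
  have v0 : tsum el v p q = 0.
    by rewrite tsum_block // => ? ?; rewrite (trilinear01 Z1lin (el_tri Z1)).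
  have v'0 i j : v' i j = 0.
    by have [//|[xi [eta ->]]] := v'E i j; rewrite -/el v0.
  rewrite -tsum_block => [|? ?]; last exact: (trilinear01 Z1lin F_tri).
  rewrite -/v -/p -/q -(v't _ _ _ Z1lin F_tri) // /tsum.
  rewrite big1 // => i _; rewrite big1 // => j _.
  by rewrite v'0 (trilinear01 Z1lin F_tri).
have /completely_contractiveP [] := phicc; [exact: Z1B|by []|].
move=> _ /(_ n z' 1 Z1z' ler01 (z'1 1 ler01 z1) x' y').
rewrite mul1r xx yy => h.
have -> : complex.Re (tsum F w a b) = - complex.Re (tsum F z' x' y').
  by apply/eqP; rewrite -addr_eq0 -ReD addrC F0.
rewrite subr_ge0; apply: le_trans h; rewrite mxform_tsum.
have -> // : tsum (@inner_form R H) (map_mx phi z') x' y' = tsum F z' x' y'.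
by apply: eq_bigr => i _; apply: eq_bigr => j _; rewrite mxE.
Qed.

Lemma wittstock_cone_bounding : bounding_cone wittstock_cone.
Proof.
have Z10 := Z1lin.1; have Z20 := Z2lin.1.
split.
- exists 0, 0, (fun=> 0), (fun=> 0), 0, 0, (fun=> 0), (fun=> 0).
  rewrite /tsum /mxbound /mxform /l2sq !big_ord0; split => /=.
  + by split=> [i|x y]; [case: i|rewrite !big_ord0 addr0 mul0r mulr0].
  + by case.
  + by rewrite addr0.
  + by rewrite !addr0 mul0r.
- move=> _ _ _ _ [n [z [x [y [m [w [a [b [[Zz zc] Zw /= -> ->]]]]]]]]]
         [n' [z' [x' [y' [m' [w' [a' [b' [[Zz' zc'] Zw' /= -> ->]]]]]]]]].
  exists (n + n')%N, (block_mx z 0 0 z'), (fcat x x'), (fcat y y').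
  exists (m + m')%N, (block_mx w 0 0 w'), (fcat a a'), (fcat b b').
  split=> /=.
  + by split; [exact: block_in|exact: mxbound_block].
  + exact: block_in.
  + rewrite !tsum_block => [|u v|u v]; rewrite 1?addrACA //;
      by rewrite (trilinear01 Z1lin (el_tri Z1)).
  + rewrite !l2sq_fcat tsum_block => [|u v]; last exact: (trilinear01 Z1lin F_tri).
    by rewrite ReD [LHS]addrACA -mulrDl [X in X / 2]addrACA.
- move=> t _ _ t0 [n [z [x [y [m [w [a [b [[Zz zc] Zw /= -> ->]]]]]]]]].
  pose s := Num.sqrt t.
  have sE : s * s = t by rewrite -expr2 sqr_sqrtr // ltW.
  exists n, z, (fun i => s%:C *: x i), (fun i => s%:C *: y i).
  exists m, w, (fun i => t%:C *: a i), b; split=> //=.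
  + rewrite (tsumZ2 (el_tri Z2)) // (tsumZ3 (el_tri Z2)) // (tsumZ2 (el_tri Z1)) //.
    by rewrite scalerA conjc_real -rmorphM sE scalerDr.
  + rewrite !l2sqZ (tsumZ2 F_tri) // [complex.Re (_ *: _)]ReZ.
    by rewrite expr2 sE; ring.
- move=> r [n [z [x [y [m [w [a [b [[Zz zc] Zw /= /esym e ->]]]]]]]]].
  exact: wittstock_consistent.
- move=> _ r [n [z [x [y [m [w [a [b [[Zz zc] Zw /= -> _]]]]]]]]].
  exists ((l2sq (fun i => -1 *: x i) + l2sq y) / 2 +
    complex.Re (tsum F w (fun i => -1 *: a i) b)).
  exists n, z, (fun i => -1 *: x i), y, m, w, (fun i => -1 *: a i), b.
  split=> //=.
  by rewrite (tsumZ2 (el_tri Z2)) // (tsumZ2 (el_tri Z1)) // !scaleN1r opprD.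
Qed.

Lemma additive_sum2 (U : zmodType) (g : U -> R) n (f : 'I_n -> 'I_n -> U) :
  (forall u v, g (u + v) = g u + g v) ->
  g (\sum_(i < n) \sum_(j < n) f i j) = \sum_(i < n) \sum_(j < n) g (f i j).
Proof.
move=> gD.
have g0 : g 0 = 0 by apply: (addrI (g 0)); rewrite -gD !addr0.
have gs (h : 'I_n -> U) : g (\sum_i h i) = \sum_i g (h i).
  by elim/big_rec2: _ => // i u v _ <-.
by rewrite gs; apply: eq_bigr => i _; exact: gs.
Qed.

(** For each operator [T] of [Z2], the functional given by the Hahn-Banach theorem
    restricts to a bounded form on [H], and this form is the required operator. *)
Theorem wittstock_extension : exists2 psi,
  completely_contractive Z2 (@bounded_operators R H) psi &
  forall T, Z1 T -> psi T = phi T.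
Proof.
have [g [gD gZ gS]] := hahn_banach_cone wittstock_cone_bounding.
have gbound1 n (z : 'M[K -> K]_n) x y : (forall i j, Z2 (z i j)) -> mxbound 1 z ->
    g (tsum el z x y) <= (l2sq x + l2sq y) / 2.
  move=> Zz z1; apply: gS.
  exists n, z, x, y, 0, 0, (fun=> 0), (fun=> 0); split=> //=.
  + by case.
  + by rewrite [tsum el 0 _ _]big_ord0 addr0.
  + by rewrite [tsum F 0 _ _]big_ord0 addr0.
have gphi1 T x y : Z1 T -> g (el T x y) <= rdot (phi T x) y.
  move=> ZT; apply: gS.
  exists 0, 0, (fun=> 0), (fun=> 0), 1, (const_mx T), (fun=> x), (fun=> y).
  split => /=.
  + by split=> [|u v]; [case|rewrite /mxform /l2sq !big_ord0 addr0 mul0r mulr0].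
  + by move=> i j; rewrite mxE.
  + by rewrite /tsum !big_ord0 !big_ord1 mxE add0r.
  + by rewrite /tsum /l2sq !big_ord0 !big_ord1 mxE addr0 mul0r add0r.
have gN u : g (- u) = - g u.
  by rewrite -scaleN1r -(rmorph1 (real_complex R)) -rmorphN gZ mulN1r.
have gphi T x y : Z1 T -> g (el T x y) = rdot (phi T x) y.
  move=> ZT; apply/eqP; rewrite eq_le gphi1 //= -lerN2 -gN -rdotNr.
  have -> : - el T x y = el T x (- y).
    by rewrite -[- y]scaleN1r (trilinearZ3 (el_tri Z1)) // rmorphN rmorph1 scaleN1r.
  exact: gphi1.
have gbound n (z : 'M[K -> K]_n) c x y : (forall i j, Z2 (z i j)) -> 0 <= c ->
    mxbound c z -> g (tsum el z x y) <= c * ((l2sq x + l2sq y) / 2).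
  move=> Zz c0 zc.
  have L0 : 0 <= (l2sq x + l2sq y) / 2 by rewrite divr_ge0 ?addr_ge0 ?l2sq_ge0.
  set L := (X in _ <= c * X) in L0 *.
  (* the bound by [d > c] follows by scaling to [d = 1] *)
  suff key d : c < d -> g (tsum el z x y) <= d * L.
    apply/ler_addgt0Pr => e e0.
    have L1 : 0 < L + 1 by rewrite (lt_le_trans ltr01) // lerDr.
    have /key h : c < c + e / (L + 1) by rewrite ltrDl divr_gt0.
    apply: le_trans h _; rewrite mulrDl lerD2l mulrAC ler_pdivrMr //.
    by rewrite ler_pM2l // lerDl.
  move=> cd; have d0 : 0 < d by exact: le_lt_trans cd.
  have zB i j : bounded_operators (z i j) by exact: Z2B.
  have zd : mxbound d z.
    move=> u v; apply: le_trans (zc u v) _.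
    by rewrite ler_wpM2r ?divr_ge0 ?addr_ge0 ?l2sq_ge0 // ltW.
  have d10 : 0 <= d^-1 by rewrite invr_ge0 ltW.
  have := mxbound_scale d10 zB zd; rewrite mulVf ?gt_eqF // => z1.
  have := gbound1 _ _ x y _ z1; rewrite (tsumZ1 Z2lin (el_tri Z2)) // gZ.
  rewrite ler_pdivrMl //; apply.
  by move=> i j; rewrite mxE; exact: linear_subset_scale.
have /choice[psi psiP] T : exists S, Z2 T ->
    bounded_operators S /\ forall x y, rdot (S x) y = g (el T x y).
  have [ZT|nZT] := pselect (Z2 T); last by exists 0.
  have ZT1 (i j : 'I_1) : bounded_operators ((const_mx T : 'M[K -> K]_1) i j).
    by rewrite mxE; exact: Z2B.
  have [c c0 Tc] := mxbound_bounded ZT1.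
  have [|||||S Sb SE] := @operator_of_form R H (fun x y => g (el T x y)) c c0.
  - move=> x y u; rewrite -gD; congr g.
    by have := trilinear2 (el_tri Z2) 1 x y u ZT; rewrite !scale1r.
  - move=> x y u; rewrite -gD; congr g.
    by have := trilinear3 (el_tri Z2) 1 u x y ZT; rewrite rmorph1 !scale1r.
  - by move=> t x y; rewrite (trilinearZ3 (el_tri Z2)) // conjc_real gZ.
  - move=> a x y.
    by rewrite (trilinearZ3 (el_tri Z2)) // conjcK (trilinearZ2 (el_tri Z2)).
  - move=> x y; have := gbound _ (const_mx T) c (fun=> x) (fun=> y) _ c0 Tc.
    rewrite /tsum /l2sq !big_ord1 mxE; apply.
    by move=> i j; rewrite mxE.
  - by exists S.
exists psi; last first.
  move=> T ZT; apply/funext => x; apply: rdot_inj => y.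
  by rewrite (psiP T (Z12 ZT)).2 gphi.
apply/completely_contractiveP => //; split.
  split=> [T ZT|a S T ZS ZT]; first by have [] := psiP T ZT.
  have ZST := Z2lin.2 a S T ZS ZT.
  apply/funext => x; apply: rdot_inj => y.
  have -> : (a *: psi S + psi T) x = a *: psi S x + psi T x by [].
  rewrite rdotDl rdotZ_conj (psiP _ ZST).2 (psiP _ ZS).2 (psiP _ ZT).2 -gD.
  by rewrite (trilinear1 (el_tri Z2)) // (trilinearZ3 (el_tri Z2)) // conjcK.
move=> n z c Zz c0 zc x y.
rewrite (_ : mxform _ x y = g (tsum el z x y)); first exact: gbound.
rewrite additive_sum2 //; apply: eq_bigr => i _; apply: eq_bigr => j _.
by rewrite mxE (psiP _ (Zz i j)).2.
Qed.

End Wittstock.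

(** * Normal functionals and the weak* closure *)

Section ComplexSeries.
Variable R : realType.
Implicit Types (u v : R[i]).

Definition cabs u : R := complex.Re `|u|.

Lemma norm_cabs u : `|u| = (cabs u)%:C.
Proof. by rewrite /cabs RRe_real ?normr_real. Qed.

Lemma cabs_ge0 u : 0 <= cabs u.
Proof. by rewrite -lecR -norm_cabs normr_ge0. Qed.

Lemma cabsD u v : cabs (u + v) <= cabs u + cabs v.
Proof. by rewrite -lecR rmorphD /= -!norm_cabs ler_normD. Qed.

Lemma cabsM u v : cabs (u * v) = cabs u * cabs v.
Proof.
apply: complexI; rewrite -norm_cabs normrM !norm_cabs.
by rewrite [RHS]rmorphM.
Qed.

Lemma cabsN u : cabs (- u) = cabs u.
Proof. by rewrite /cabs normrN. Qed.

Lemma cabs0 : cabs 0 = 0.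
Proof. by rewrite /cabs normr0. Qed.

Lemma cabs_sum (I : Type) (r : seq I) (P : pred I) (F : I -> R[i]) :
  cabs (\sum_(i <- r | P i) F i) <= \sum_(i <- r | P i) cabs (F i).
Proof.
elim/big_rec2: _ => [|i x y _ h]; first by rewrite cabs0.
by apply: le_trans (cabsD _ _) _; rewrite lerD2l.
Qed.

Lemma cabsE u : cabs u = Num.sqrt (complex.Re u ^+ 2 + complex.Im u ^+ 2).
Proof. by rewrite /cabs normc_def. Qed.

Lemma Re_le_cabs u : `|complex.Re u| <= cabs u.
Proof. by rewrite cabsE -sqrtr_sqr ler_wsqrtr // lerDl sqr_ge0. Qed.

Lemma Im_le_cabs u : `|complex.Im u| <= cabs u.
Proof. by rewrite cabsE -sqrtr_sqr ler_wsqrtr // lerDr sqr_ge0. Qed.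

Lemma cabs_le u : cabs u <= `|complex.Re u| + `|complex.Im u|.
Proof.
rewrite cabsE -[leRHS]ger0_norm ?addr_ge0 // -sqrtr_sqr ler_wsqrtr //.
rewrite sqrrD -!normrX !(ger0_norm (sqr_ge0 _)) lerD2r lerDl.
by rewrite mulrn_wge0 // mulr_ge0.
Qed.

(** The estimate of the remainders depends only on the majorant [d]; this is what
    makes normal functionals limits of finite sums uniformly on bounded sets of
    operators. *)
Lemma complex_series_cvg (u : nat -> R[i]^o) (d : nat -> R) :
    (forall k, cabs (u k) <= d k) -> cvgn (series d) ->
  cvgn (series u) /\
  forall N, cabs (limn (series u) - series u N) <= limn (series d) - series d N.
Proof.
move=> ud cd.
have d0 k : 0 <= d k by apply: le_trans (ud k); exact: cabs_ge0.
have real_part (f : R[i] -> R) : (forall v, `|f v| <= cabs v) ->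
    cvgn (series (f \o u)).
  move=> fle; apply: normed_cvg; apply: (series_le_cvg _ d0 _ cd) => k.
    exact: normr_ge0.
  by apply: le_trans (ud k); exact: fle.
have := real_part (@complex.Re R) Re_le_cabs; set a := lim _ => ua.
have := real_part (@complex.Im R) Im_le_cabs; set b := lim _ => ub.
have ReS N : complex.Re (series u N) = series (@complex.Re R \o u) N.
  by rewrite /series /=; elim/big_rec2: _ => //= i x y _ <-; rewrite ReD.
have ImS N : complex.Im (series u N) = series (@complex.Im R \o u) N.
  by rewrite /series /=; elim/big_rec2: _ => //= i x y _ <-; case: (u i); case: y.
have ul : series u @ \oo --> (a +i* b : R[i]^o).
  apply/cvgrPdist_lt => e e0.
  have eE : e = (complex.Re e)%:C by rewrite RRe_real // gtr0_real.
  have e2 : 0 < complex.Re e / 2 by rewrite divr_gt0 // -ltcR -eE.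
  have /cvgrPdist_lt/(_ _ e2) := ua; have /cvgrPdist_lt/(_ _ e2) := ub.
  apply: filterS2 => n bn an; rewrite norm_cabs eE ltcR.
  apply: le_lt_trans (cabs_le _) _; rewrite [ltRHS]splitr.
  by apply: ltrD; [move: an; rewrite -ReS|move: bn; rewrite -ImS];
    case: (series u n).
split; first by apply/cvg_ex; exists (a +i* b).
move=> N; have -> : limn (series u) = (a +i* b : R[i]^o) by apply/cvg_lim.
apply/ler_addgt0Pr => e e0.
have e0' : 0 < (e%:C : R[i]) by rewrite ltcR.
have /cvgrPdist_lt/(_ _ e0')[M _ MP] := ul.
pose n := maxn M N.
have := MP n (leq_maxl _ _); rewrite /= norm_cabs ltcR => un.
have -> : (a +i* b : R[i]) - series u N =
    (a +i* b - series u n) + (series u n - series u N) by rewrite addrA subrK.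
apply: le_trans (cabsD _ _) _; rewrite addrC lerD ?(ltW un) //.
rewrite sub_series_geq ?leq_maxr //.
apply: le_trans (cabs_sum _ _ _) _.
apply: (@le_trans _ _ (series d n - series d N)).
  by rewrite sub_series_geq ?leq_maxr // ler_sum.
rewrite lerB // nondecreasing_cvgn_le //.
by apply: nondecreasing_series => k _.
Qed.

End ComplexSeries.

Section NormalFunctionals.
Variables (R : realType) (H : hilbertType R).
Implicit Types (S T : H -> H) (x y : nat -> H).

Lemma cabs_inner (x y : H) : cabs (inner x y) <= hnorm x ^+ 2 + hnorm y ^+ 2.
Proof.
apply: le_trans (cabs_le _) _; rewrite innerE /=.
have le2 (z : H) : hnorm z = hnorm y ->
    `|rdot x z| <= (hnorm x ^+ 2 + hnorm y ^+ 2) / 2.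
  move=> <-; rewrite ler_norml lerNl -rdotNl; apply/andP; split.
    by rewrite -(hnormN x); exact: rdot_le_sqr.
  exact: rdot_le_sqr.
have := le2 y erefl; have := le2 ('i *: y).
rewrite hnormZ normc_def /= expr0n expr1n add0r sqrtr1 mul1r => /(_ erefl); lra.
Qed.

Lemma normal_functional_cvg x y T C :
  square_summable x -> square_summable y -> 0 <= C ->
  (forall v, hnorm (T v) <= C * hnorm v) ->
  let d k := C ^+ 2 * hnorm (x k) ^+ 2 + hnorm (y k) ^+ 2 in
  [/\ cvgn (series d),
      cvgn (series (fun k => inner (T (x k)) (y k) : R[i]^o)) &
      forall N, cabs (normal_functional x y T -
                      \sum_(0 <= k < N) inner (T (x k)) (y k)) <=
                limn (series d) - series d N].
Proof.
move=> sx sy C0 TC d.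
have cd : cvgn (series d).
  pose f : R^o^nat := fun k => hnorm (x k) ^+ 2.
  pose g : R^o^nat := fun k => hnorm (y k) ^+ 2.
  have -> : d = (C ^+ 2 *: f) + g by [].
  by apply: is_cvg_seriesD => //; exact: is_cvg_seriesZ.
have [] := @complex_series_cvg _ (fun k => inner (T (x k)) (y k) : R[i]^o) d _ cd.
  move=> k; apply: le_trans (cabs_inner _ _) _; rewrite lerD2r -exprMn.
  by rewrite ler_pXn2r ?nnegrE ?mulr_ge0 ?hnorm_ge0.
by split.
Qed.

Lemma normal_functional_linear x y (a : R[i]) S T :
  square_summable x -> square_summable y ->
  bounded_operators S -> bounded_operators T ->
  normal_functional x y (a *: S + T) =
  a * normal_functional x y S + normal_functional x y T.
Proof.
move=> sx sy /bounded_operatorsP[_ [C C0 SC]] /bounded_operatorsP[_ [D D0 TD]].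
have [_ cS _] := normal_functional_cvg sx sy C0 SC.
have [_ cT _] := normal_functional_cvg sx sy D0 TD.
pose f : R[i]^o^nat := fun k => inner (S (x k)) (y k).
pose g : R[i]^o^nat := fun k => inner (T (x k)) (y k).
have E N : series (fun k => inner ((a *: S + T) (x k)) (y k) : R[i]^o) N =
    a *: series f N + series g N.
  rewrite /series /= scaler_sumr -big_split; apply: eq_bigr => k _.
  by rewrite innerDl innerZl.
have h : (fun N => a *: series f N + series g N) @ \oo -->
    (a *: limn (series f) + limn (series g) : R[i]^o).
  by apply: cvgD; [apply: cvgZl_tmp; exact: cS|exact: cT].
have := cvg_lim (@norm_hausdorff _ _) h.
by rewrite -(funext E) => e; exact: e.
Qed.

End NormalFunctionals.

Section WeakStarClosure.
Variables (R : realType) (H : hilbertType R) (V : set (H -> H)).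
Implicit Types (S T : H -> H) (x y : nat -> H).

Let W := weakstar_closure V.

Lemma weakstar_closure_bounded : W `<=` @bounded_operators R H.
Proof. by move=> T []. Qed.

Lemma weakstar_closed T : bounded_operators T ->
  (forall m (x y : 'I_m -> nat -> H),
     (forall l, square_summable (x l)) -> (forall l, square_summable (y l)) ->
     forall e : R, 0 < e -> exists2 S, W S &
       forall l, cabs (normal_functional (x l) (y l) T
                       - normal_functional (x l) (y l) S) < e) -> W T.
Proof.
move=> Tb TW; split=> // m x y sx sy e e0.
have e20 : 0 < e / 2 by rewrite divr_gt0.
have [S [_ SV] TS] := TW m x y sx sy _ e20.
have [S' VS' SS'] := SV m x y sx sy _ e20.
exists S' => // l; rewrite -/(cabs _).
have -> : normal_functional (x l) (y l) T - normal_functional (x l) (y l) S' =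
  (normal_functional (x l) (y l) T - normal_functional (x l) (y l) S) +
  (normal_functional (x l) (y l) S - normal_functional (x l) (y l) S').
  by rewrite addrA subrK.
apply: le_lt_trans (cabsD _ _) _; rewrite [ltRHS]splitr.
by apply: ltrD; [exact: TS|exact: SS'].
Qed.

Hypothesis Vs : operator_space V.

Lemma subset_weakstar_closure : V `<=` W.
Proof.
move=> T VT; split; first by case: Vs => VB _ _; exact: VB.
by move=> m x y _ _ e e0; exists T => // l; rewrite subrr -/(cabs _) cabs0.
Qed.

Lemma weakstar_closure_operator_space : operator_space W.
Proof.
have [VB V0 VD] := Vs; split; first exact: weakstar_closure_bounded.
  exact: subset_weakstar_closure.
move=> a S T [Sb SV] [Tb TV]; split.
  by have [_ _] := bounded_operator_space H; apply.
move=> m x y sx sy e e0.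
have a1 : 0 < cabs a + 1 by rewrite (lt_le_trans ltr01) // lerDr cabs_ge0.
have e20 : 0 < e / 2 by rewrite divr_gt0.
have e2a : 0 < e / 2 / (cabs a + 1) by rewrite divr_gt0.
have [S' VS' SS'] := SV m x y sx sy _ e2a.
have [T' VT' TT'] := TV m x y sx sy _ e20.
exists (a *: S' + T'); first exact: VD.
move=> l; rewrite -/(cabs _) !normal_functional_linear //; try exact: VB.
set s := normal_functional _ _ S; set t := normal_functional _ _ T.
set s' := normal_functional _ _ S'; set t' := normal_functional _ _ T'.
have -> : a * s + t - (a * s' + t') = a * (s - s') + (t - t') by ring.
apply: le_lt_trans (cabsD _ _) _; rewrite [ltRHS]splitr.
apply: ler_ltD; last exact: TT'.
rewrite cabsM; apply: (@le_trans _ _ ((cabs a + 1) * (e / 2 / (cabs a + 1)))).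
  apply: ler_pM; rewrite ?cabs_ge0 ?lerDl //; exact: ltW (SS' l).
by rewrite mulrC divfK // gt_eqF.
Qed.

End WeakStarClosure.

(** * Limits of V-maps *)

Section UltraLimits.
Variable R : realType.

Lemma ultra_fmap (I T : Type) (G : set_system I) (f : I -> T) :
  UltraFilter G -> UltraFilter (f @ G).
Proof.
move=> GU; split => [|F FF sub]; first exact: fmap_proper_filter.
rewrite predeqE => B; split; last exact: sub.
move=> FB; have [//|GnB] := in_ultra_setVsetC (f @^-1` B) GU.
have FnB : F (~` B) by exact: sub.
have : F (B `&` ~` B) by exact: filterI.
by rewrite setICr => /filter_not_empty.
Qed.

Lemma ultra_bounded_cvg (I : Type) (G : set_system I) (f : I -> R) c :
  UltraFilter G -> (forall i, `|f i| <= c) -> cvg (f @ G).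
Proof.
move=> GU fc; have fU := ultra_fmap f GU.
have := @segment_compact R (- c) c; rewrite compact_ultra => /(_ _ fU)[].
  by apply: nearW => i /=; rewrite in_itv /= -ler_norml.
by move=> l [_ fl]; apply/cvg_ex; exists l.
Qed.

End UltraLimits.

Section LimitsOfVMaps.
Variables (R : realType) (H : hilbertType R) (V : set (H -> H)).
Hypothesis Vs : operator_space V.
Let W := weakstar_closure V.
Let Ws : operator_space W := weakstar_closure_operator_space Vs.
Let WB : W `<=` @bounded_operators R H := @weakstar_closure_bounded R H V.

Lemma hnorm_le_opnorm (T : H -> H) c v : bounded_operators T -> 0 <= c ->
  opnorm T <= c -> hnorm (T v) <= c * hnorm v.
Proof.
move=> Tb c0; rewrite opnorm_mxopnorm mxopnorm_leP // => [|i j]; last by rewrite mxE.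
move=> /(mxbound_act (fun=> v) c0).
rewrite /l2sq !big_ord1 /mxact big_ord1 mxE -exprMn.
by rewrite ler_pXn2r // ?nnegrE ?mulr_ge0 ?hnorm_ge0.
Qed.

Lemma V_map_opnorm phi T : V_map V W phi -> W T -> opnorm (phi T) <= opnorm T.
Proof. by move=> [cc _] WT; exact: (completely_contractive_opnorm cc). Qed.

Lemma V_map_in phi T : V_map V W phi -> W T -> W (phi T).
Proof. by move=> [[[h _] _] _]; exact: h. Qed.

(** Bounded nets converging in the weak operator topology converge weak*: up to a
    uniformly small remainder, a normal functional is a finite sum of matrix
    coefficients. *)
Lemma normal_functional_limit (I : Type) (G : set_system I)
    (Q : I -> H -> H) T c x y :
  ProperFilter G -> 0 <= c ->
  (forall i v, hnorm (Q i v) <= c * hnorm v) ->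
  (forall v, hnorm (T v) <= c * hnorm v) ->
  (forall u v, rdot (Q i u) v @[i --> G] --> rdot (T u) v) ->
  square_summable x -> square_summable y ->
  forall e : R, 0 < e ->
  \forall i \near G, cabs (normal_functional x y T - normal_functional x y (Q i)) < e.
Proof.
move=> GF c0 Qc Tc QT sx sy e e0.
have [cd _ _] := normal_functional_cvg sx sy c0 Tc.
set d := (X in series X) in cd.
have e40 : 0 < e / 4 by rewrite divr_gt0.
have [N _ NP] : \forall N \near \oo, limn (series d) - series d N < e / 4.
  have /cvgrPdist_lt/(_ _ e40) := cd.
  by apply: filterS => n; apply: le_lt_trans; exact: ler_norm.
have {}NP := NP N (leqnn N).
have tail S : (forall v, hnorm (S v) <= c * hnorm v) ->
    cabs (normal_functional x y S -
          \sum_(0 <= k < N) inner (S (x k)) (y k)) < e / 4.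
  move=> /(normal_functional_cvg sx sy c0)[_ _ /(_ N)] h.
  exact: le_lt_trans NP.
pose D i := \sum_(0 <= k < N)
  (`|rdot (T (x k)) (y k) - rdot (Q i (x k)) (y k)| +
  `|rdot (T (x k)) ('i *: y k) - rdot (Q i (x k)) ('i *: y k)|).
have D0 : D i @[i --> G] --> (0 : R).
  have z u v : `|rdot (T u) v - rdot (Q i u) v| @[i --> G] --> (0 : R).
    rewrite -(normr0 R) -(subrr (rdot (T u) v)); apply: cvg_norm.
    by apply: cvgB => //; exact: cvg_cst.
  have -> : (0 : R) = \sum_(0 <= k < N) (0 + 0) by rewrite big1 // => k _; rewrite addr0.
  rewrite /D; elim: (N) => [|M IH].
    by rewrite big_nil; under eq_fun do rewrite big_nil; exact: cvg_cst.
  rewrite big_nat_recr //=; under eq_fun do rewrite big_nat_recr //=.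
  by apply: cvgD => //; apply: cvgD.
have /cvgrPdist_lt/(_ _ e40) := D0.
apply: filterS => i; rewrite sub0r normrN ger0_norm; last first.
  by apply: sumr_ge0 => k _; rewrite addr_ge0.
move=> Di.
have := tail (Q i) (Qc i); have := tail T Tc.
set sT := \sum_(0 <= k < N) _; set sQ := \sum_(0 <= k < N) _.
set nT := normal_functional x y T; set nQ := normal_functional x y (Q i).
move=> hT hQ.
have hD : cabs (sT - sQ) <= D i.
  rewrite /sT /sQ -sumrB; apply: le_trans (cabs_sum _ _ _) _.
  apply: ler_sum => k _; rewrite !innerE.
  by apply: le_trans (cabs_le _) _.
have -> : nT - nQ = (nT - sT) + (sT - sQ) + - (nQ - sQ) by ring.
apply: le_lt_trans (cabsD _ _) _; rewrite cabsN.
have := cabsD (nT - sT) (sT - sQ); lra.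
Qed.

(** The weak* closure being weak* closed, the V-maps form a compact set for the
    point-weak* topology, on which the V-seminorms are lower semicontinuous. *)
Lemma ultralimit_V_map (I : Type) (G : set_system I) (Q : I -> (H -> H) -> (H -> H)) :
  UltraFilter G -> (forall i, V_map V W (Q i)) ->
  exists2 phi, V_map V W phi &
    forall T c, W T -> 0 <= c -> (\forall i \near G, opnorm (Q i T) <= c) ->
      opnorm (phi T) <= c.
Proof.
move=> GU QV.
have QB i T : W T -> bounded_operators (Q i T).
  by move=> WT; apply: WB; exact: V_map_in.
have Qle T i x y : W T ->
    rdot (Q i T x) y <= opnorm T * ((hnorm x ^+ 2 + hnorm y ^+ 2) / 2).
  move=> WT; have /opnorm_leP := V_map_opnorm (QV i) WT; apply; first exact: QB.
  by apply: opnorm_ge0; exact: WB.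
have Qlin i T : W T -> linear (Q i T) by move=> /(QB i)[].
have /choice[phi phiP] T : exists S, W T -> bounded_operators S /\
    forall x y, rdot (Q i T x) y @[i --> G] --> rdot (S x) y.
  have [WT|nWT] := pselect (W T); last by exists 0.
  pose s x y := lim (rdot (Q i T x) y @[i --> G]).
  have sP x y : rdot (Q i T x) y @[i --> G] --> s x y.
    pose b := opnorm T * ((hnorm x ^+ 2 + hnorm y ^+ 2) / 2).
    apply: (@ultra_bounded_cvg _ _ _ _ b) => i; rewrite /b.
    rewrite ler_norml lerNl -rdotNr Qle // andbT -(hnormN y); exact: Qle.
  have sE x y l : rdot (Q i T x) y @[i --> G] --> l -> s x y = l.
    exact: cvg_lim.
  have [|||||S Sb SE] := @operator_of_form R H s (opnorm T) (opnorm_ge0 (WB WT)).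
  - move=> x y z; apply: sE.
    under eq_fun do rewrite (linear_add _ _ (Qlin _ _ WT)) rdotDl.
    by apply: cvgD; exact: sP.
  - move=> x y z; apply: sE.
    under eq_fun do rewrite rdotDr.
    by apply: cvgD; exact: sP.
  - move=> t x y; apply: sE.
    under eq_fun do rewrite rdotZr.
    by apply: cvgM; [exact: cvg_cst|exact: sP].
  - move=> a x y; apply: sE.
    under eq_fun do rewrite (linear_scale _ _ (Qlin _ _ WT)) rdotZ_conj.
    exact: sP.
  - move=> x y; apply: (cvgr_to_le (sP x y)).
    by apply: nearW => i; exact: Qle.
  by exists S => _; split => // x y; rewrite SE.
have phic T c : W T -> 0 <= c -> (\forall i \near G, opnorm (Q i T) <= c) ->
    opnorm (phi T) <= c.
  move=> WT c0 Qc; have [Sb SP] := phiP T WT.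
  apply/opnorm_leP => // x y; apply: (cvgr_to_le (SP x y)).
  by apply: filterS Qc => i /opnorm_leP; apply => //; exact: QB.
have phiW T : W T -> W (phi T).
  move=> WT; have [Sb SP] := phiP T WT; have Tb := WB WT; have T0 := opnorm_ge0 Tb.
  apply: weakstar_closed => // m x y sx sy e e0.
  have : \forall i \near G, forall l,
      cabs (normal_functional (x l) (y l) (phi T)
            - normal_functional (x l) (y l) (Q i T)) < e.
    apply: filter_forall => l.
    apply: (normal_functional_limit (c := opnorm T)) => //.
    - by move=> i v; apply: hnorm_le_opnorm => //; [exact: QB|exact: V_map_opnorm].
    - move=> v; apply: hnorm_le_opnorm => //; apply: phic => //.
      by apply: nearW => i; exact: V_map_opnorm.
  by move=> /filter_ex[i iP]; exists (Q i T) => //; exact: V_map_in.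
have cvg_eq (u : I -> R) (l l' : R) : u @ G --> l -> u @ G --> l' -> l = l'.
  by move=> ul ul'; rewrite -(cvg_lim (@norm_hausdorff _ _) ul);
    exact: (cvg_lim (@norm_hausdorff _ _) ul').
exists phi => //; split; last first.
  move=> T VT; have WT := subset_weakstar_closure Vs VT.
  apply/funext => x; apply: rdot_inj => y.
  apply: (cvg_eq _ _ _ ((phiP T WT).2 x y)).
  by under eq_fun do rewrite (QV _).2 //; exact: cvg_cst.
apply/completely_contractiveP => //; split.
  split=> // a S T WS WT; apply/funext => x; apply: rdot_inj => y.
  have WST : W (a *: S + T) by have [_ _] := Ws; apply.
  apply: (cvg_eq _ _ _ ((phiP _ WST).2 x y)).
  have -> : (a *: phi S + phi T) x = a *: phi S x + phi T x by [].
  have QE i : rdot (Q i (a *: S + T) x) y =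
      rdot (Q i S x) (conjc a *: y) + rdot (Q i T x) y.
    have [[[_ lin] _] _] := QV i.
    by rewrite (lin _ _ _ WS WT) -rdotZ_conj -rdotDl.
  under eq_fun do rewrite QE.
  rewrite rdotDl rdotZ_conj.
  by apply: cvgD; [exact: (phiP S WS).2|exact: (phiP T WT).2].
move=> n A c WA c0 Ac x y.
suff h : mxform (map_mx (Q i) A) x y @[i --> G] --> mxform (map_mx phi A) x y.
  apply: (cvgr_to_le h); apply: nearW => i.
  by have [/completely_contractiveP[] // _ ctr _] := QV i; exact: ctr.
have QE i : mxform (map_mx (Q i) A) x y =
    \sum_(p < n) \sum_(q < n) rdot (Q i (A p q) (x q)) (y p).
  by apply: eq_bigr => p _; apply: eq_bigr => q _; rewrite mxE.
under eq_fun do rewrite QE.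
rewrite (_ : mxform _ x y =
    \sum_(p < n) \sum_(q < n) rdot (phi (A p q) (x q)) (y p)); last first.
  by apply: eq_bigr => p _; apply: eq_bigr => q _; rewrite mxE.
have sum_cvg (f : 'I_n -> I -> R) (l : 'I_n -> R) : (forall p, f p @ G --> l p) ->
    (\sum_p f p i) @[i --> G] --> \sum_p l p.
  by move=> fl; apply: cvg_big => // -[u v]; exact: add_continuous.
apply: (sum_cvg (fun p i => \sum_(q < n) rdot (Q i (A p q) (x q)) (y p))) => p.
apply: (sum_cvg (fun q i => rdot (Q i (A p q) (x q)) (y p))) => q.
exact: (phiP _ (WA p q)).2.
Qed.

End LimitsOfVMaps.

(** * Injective spaces and complete contractions *)

Section CompleteMapCalculus.
Variable R : realType.

Lemma completely_contractive_comp (H K L : hilbertType R) (X : set (H -> H))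
    (Y : set (K -> K)) (Z : set (L -> L)) f g :
  completely_contractive X Y f -> completely_contractive Y Z g ->
  completely_contractive X Z (g \o f).
Proof.
move=> [[fY flin] fc] [[gZ glin] gc]; split; first split.
- by move=> T XT; exact/gZ/fY.
- by move=> a S T XS XT /=; rewrite flin // glin //; exact: fY.
- move=> n A XA; rewrite map_mx_comp; apply: le_trans (fc _ _ XA).
  by apply: gc => i j; rewrite mxE; exact: fY.
Qed.

Lemma completely_contractive_sub (H K : hilbertType R) (X X' : set (H -> H))
    (Y Y' : set (K -> K)) f :
  X' `<=` X -> Y `<=` Y' ->
  completely_contractive X Y f -> completely_contractive X' Y' f.
Proof.
move=> XX YY [[fY flin] fc]; split; first split.
- by move=> T /XX/fY/YY.
- by move=> a S T /XX XS /XX XT; exact: flin.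
- by move=> n A X'A; apply: fc => i j; exact: XX.
Qed.

Lemma completely_contractive_id (H : hilbertType R) (X : set (H -> H)) :
  completely_contractive X X id.
Proof. by split=> // n A _; rewrite map_mx_id. Qed.

Lemma completely_isometric_id (H : hilbertType R) (X Y : set (H -> H)) :
  X `<=` Y -> completely_isometric X Y id.
Proof. by move=> XY; split=> // n A _; rewrite map_mx_id. Qed.

Lemma completely_isometric_contractive (H K : hilbertType R) (X : set (H -> H))
    (Y : set (K -> K)) f : completely_isometric X Y f -> completely_contractive X Y f.
Proof. by move=> [flin fi]; split=> // n A XA; rewrite fi. Qed.

(** The inverse of [u] is completely contractive on [Y], so an extension found in
    [Y] can be brought back to [X]. *)
Lemma injective_completely_isometric (H K : hilbertType R) (X : set (H -> H))
    (Y : set (K -> K)) u :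
  operator_space X -> injective_operator_space Y ->
  completely_isometric X Y u -> u @` X = Y -> injective_operator_space X.
Proof.
move=> Xs [Ys Yinj] ui uX; split=> // L Z1 Z2 Z1s Z2s Z12 phi phic.
have [XB X0 XD] := Xs; have [YB _ YD] := Ys.
have [[uY ulin] unorm] := ui.
have uinj S T : X S -> X T -> u S = u T -> S = T.
  move=> XS XT uST.
  have XST : X (-1 *: S + T) by exact: XD.
  have uST0 : u (-1 *: S + T) = 0 by rewrite ulin // uST scaleN1r addNr.
  have Z : opnorm (-1 *: S + T) = opnorm (0 : K -> K).
    rewrite !opnorm_mxopnorm -uST0.
    have /unorm <- : forall i j : 'I_1,
        X ((const_mx (-1 *: S + T) : 'M[H -> H]_1) i j).
      by move=> i j; rewrite mxE.
    by congr mxopnorm; apply/matrixP => i j; rewrite !mxE.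
  have O0 : opnorm (0 : K -> K) = 0.
    have B0 : bounded_operators (0 : K -> K).
      by have [] := bounded_operator_space K.
    apply/eqP; rewrite eq_le opnorm_ge0 // andbT; apply/opnorm_leP => // x y.
    by rewrite mul0r [rdot _ _]rdot0l.
  move: Z; rewrite O0 => /opnorm_eq0 -/(_ (XB _ XST)) /eqP.
  by rewrite scaleN1r addrC subr_eq0 => /eqP.
have /choice[v vP] T : exists S, Y T -> X S /\ u S = T.
  have [|nYT] := pselect (Y T); last by exists 0.
  by rewrite -{1}uX => -[S XS uS]; exists S.
have vu T : X T -> v (u T) = T.
  move=> XT; have [XvT uvT] := vP _ (uY _ XT); exact: uinj.
have vc : completely_contractive Y X v.
  split; first split.
  - by move=> T /vP[].
  - move=> a S T YS YT; have [XS uS] := vP _ YS; have [XT uT] := vP _ YT.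
    apply: uinj; [exact: (vP _ (YD a S T YS YT)).1|exact: XD|].
    by rewrite (vP _ (YD a S T YS YT)).2 ulin // uS uT.
  - move=> n A YA; rewrite -(unorm _ (map_mx v A)) => [|i j]; last first.
      by rewrite mxE; exact: (vP _ (YA i j)).1.
    rewrite (_ : map_mx u _ = A) //; apply/matrixP => i j.
    by rewrite !mxE (vP _ (YA i j)).2.
have upc := completely_contractive_comp phic (completely_isometric_contractive ui).
have [psi psic psiE] := Yinj L Z1 Z2 Z1s Z2s Z12 _ upc.
exists (v \o psi); first exact: completely_contractive_comp psic vc.
by move=> T ZT; rewrite /= psiE // vu //; case: phic => -[h _] _; exact: h.
Qed.

(** Extend into the space of all operators by Wittstock's theorem, then project back
    onto [Y]. *)
Lemma injective_of_projection (H : hilbertType R) (Y : set (H -> H)) P :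
  operator_space Y -> completely_contractive (@bounded_operators R H) Y P ->
  (forall T, Y T -> P T = T) -> injective_operator_space Y.
Proof.
move=> Ys Pc PE; split=> // L Z1 Z2 Z1s Z2s Z12 phi phic.
have YB : Y `<=` @bounded_operators R H by case: Ys.
have [psi psic psiE] := wittstock_extension Z1s Z2s Z12
  (completely_contractive_sub (@subset_refl _ Z1) YB phic).
exists (P \o psi); first exact: completely_contractive_comp psic Pc.
by move=> T ZT; rewrite /= psiE // PE //; case: phic => -[h _] _; exact: h.
Qed.

End CompleteMapCalculus.

(** * Minimal V-projections and the rigidity of their ranges *)

Section MinimalProjections.
Variables (R : realType) (H : hilbertType R) (V : set (H -> H)).
Hypothesis Vs : operator_space V.
Let W := weakstar_closure V.
Let Ws : operator_space W := weakstar_closure_operator_space Vs.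
Let WB : W `<=` @bounded_operators R H := @weakstar_closure_bounded R H V.
Let Wlin : linear_subset W := operator_space_linear Ws.

Lemma V_map_id : V_map V W id.
Proof. by split=> //; exact: completely_contractive_id. Qed.

Lemma V_map_comp phi psi : V_map V W phi -> V_map V W psi -> V_map V W (phi \o psi).
Proof.
move=> [phic phiV] [psic psiV]; split; first exact: completely_contractive_comp psic phic.
by move=> T VT /=; rewrite psiV // phiV.
Qed.

(** By Zorn's lemma for the order of V-seminorms: a limit of a chain of V-maps along an
    ultrafilter containing its tails is a lower bound of the chain. *)
Theorem exists_minimal_V_projection : exists E, minimal_V_projection V W E.
Proof.
pose VM := {phi | V_map V W phi}.
pose le (p q : VM) :=
  `[< forall T, W T -> opnorm (sval q T) <= opnorm (sval p T) >].
have lexx p : le p p by apply/asboolP.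
have letr p q r : le p q -> le q r -> le p r.
  move=> /asboolP pq /asboolP qr; apply/asboolP => T WT.
  by apply: le_trans (pq T WT); exact: qr.
have [A Atot|E Emax] := ZL_preorder (exist _ id V_map_id : VM) lexx letr.
  have [[p0 Ap0]|A0] := pselect (A !=set0); last first.
    by exists (exist _ id V_map_id) => p Ap; exfalso; apply: A0; exists p.
  pose F := filter_from A (fun p => [set q | le p q]).
  have FF : ProperFilter F.
    apply: filter_from_proper; last by move=> p _; exists p; exact: lexx.
    apply: filter_from_filter; first by exists p0.
    move=> p q Ap Aq; have [pq|qp] := Atot p q Ap Aq.
      by exists q => // r qr; split => //; exact: letr pq qr.
    by exists p => // r pr; split => //; exact: letr qp pr.
  have [G [GU FG]] := ultraFilterLemma FF.
  have [phi phiV phile] := ultralimit_V_map Vs GU (fun p : VM => svalP p).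
  exists (exist _ phi phiV) => p Ap; apply/asboolP => T WT /=.
  apply: phile => //.
    by apply: opnorm_ge0; apply: WB; apply: V_map_in => //; exact: svalP.
  apply: FG; exists p => // q /asboolP; exact.
exists (sval E); split; first exact: svalP.
move=> phi phiV phiE T WT; apply/eqP; rewrite eq_le phiE //=.
have /asboolP : le (exist _ phi phiV) E by apply: Emax; apply/asboolP.
exact.
Qed.

Section Average.
Variables (n : nat) (Q : 'I_n.+1 -> (H -> H) -> (H -> H)).
Hypothesis QV : forall k, V_map V W (Q k).

Let c : R := n.+1%:R^-1.

Definition average T := c%:C *: \sum_k Q k T.

Lemma rdot_average T x y : rdot (average T x) y = c * \sum_k rdot (Q k T x) y.
Proof.
have -> : average T x = c%:C *: (\sum_k Q k T x).
  rewrite /average; congr (_ *: _).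
  by elim/big_rec2: _ => // k u v _ <-.
by rewrite rdotZl rdot_suml.
Qed.

Lemma average_le (f : 'I_n.+1 -> R) l :
  (forall k, f k <= l) -> c * \sum_k f k <= l.
Proof.
move=> fl; rewrite /c mulrC ler_pdivrMr ?ltr0n //.
apply: le_trans (ler_sum _ (fun k _ => fl k)) _.
by rewrite sumr_const card_ord mulr_natr.
Qed.

Lemma V_map_average : V_map V W average.
Proof.
split; last first.
  move=> T VT; rewrite /average (eq_bigr (fun=> T)) => [|k _]; last by rewrite (QV k).2.
  rewrite sumr_const card_ord -scaler_nat scalerA.
  rewrite -[n.+1%:R](rmorph_nat (real_complex R)).
  by rewrite -rmorphM mulVf ?pnatr_eq0 // rmorph1 scale1r.
apply/completely_contractiveP => //; split.
  split=> [T WT|a S T WS WT].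
    apply: linear_subset_scale => //; apply: linear_subset_sum => // k _.
    exact: V_map_in.
  rewrite /average scalerA mulrC -scalerA -scalerDr; congr (_ *: _).
  rewrite scaler_sumr -big_split; apply: eq_bigr => k _.
  by have [[[_ lin] _] _] := QV k; rewrite (lin _ _ _ WS WT).
move=> m A d WA d0 Ad x y.
have -> : mxform (map_mx average A) x y =
    c * \sum_k mxform (map_mx (Q k) A) x y.
  rewrite exchange_big /= mulr_sumr; apply: eq_bigr => i _.
  rewrite exchange_big /= mulr_sumr; apply: eq_bigr => j _.
  by rewrite mxE rdot_average; congr (_ * _); apply: eq_bigr => k _; rewrite mxE.
apply: average_le => k.
by have [/completely_contractiveP[] // _ h _] := QV k; exact: h.
Qed.

Lemma opnorm_average T d : W T -> 0 <= d -> (forall k, opnorm (Q k T) <= d) ->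
  opnorm (average T) <= d.
Proof.
move=> WT d0 Qd; apply/opnorm_leP => // [|x y].
  by apply: WB; apply: V_map_in WT; exact: V_map_average.
rewrite rdot_average; apply: average_le => k.
by have /opnorm_leP := Qd k; apply => //; apply: WB; exact: V_map_in.
Qed.

End Average.

Lemma V_map_sub phi S T : V_map V W phi -> W S -> W T -> phi (S - T) = phi S - phi T.
Proof.
move=> [[[_ lin] _] _] WS WT.
by rewrite addrC -scaleN1r lin // scaleN1r addrC.
Qed.

(** With [theta] the composite of [phi] and [E], the Cesaro means of the powers of
    [theta] have V-seminorms below that of [E], hence equal to it; but they tend to
    zero on the range of the identity minus [theta], so [E] vanishes there. *)
Lemma minimal_V_projection_absorbs E phi T : minimal_V_projection V W E ->
  V_map V W phi -> W T -> E (phi (E T)) = E T.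
Proof.
move=> [EV Emin] phiV WT; pose theta := phi \o E.
have thV : V_map V W theta by exact: V_map_comp.
have itV k : V_map V W (iter k theta).
  elim: k => [|k IH]; first exact: V_map_id.
  exact: (V_map_comp thV IH).
have Wit k S : W S -> W (iter k theta S) by move=> WS; exact: (V_map_in (itV k)).
have WE S : W S -> W (E S) by exact: V_map_in.
pose psi n := average (fun k : 'I_n.+1 => iter k.+1 theta).
have psiV n : V_map V W (psi n) by apply: V_map_average => k; exact: (itV k.+1).
have psiE n S : W S -> opnorm (psi n S) = opnorm (E S).
  apply: Emin => // {}S WS; apply: opnorm_average => //.
    by apply: opnorm_ge0; exact/WB/WE.
  move=> k; rewrite iterSr.
  apply: le_trans (V_map_opnorm (itV k) _) _; first exact: (Wit 1%N).
  exact: V_map_opnorm phiV (WE _ WS).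
have Wth : W (theta T) by exact: (Wit 1%N).
(* on [S], the sums of powers of [theta] telescope *)
pose S := T - theta T.
have WS : W S.
  by rewrite /S addrC -scaleN1r; case: Wlin => _; apply.
have psiS n : psi n S = (n.+1%:R^-1)%:C *: (theta T - iter n.+2 theta T).
  rewrite /psi /average; congr (_ *: _).
  rewrite (eq_bigr (fun k : 'I_n.+1 => - (iter k.+2 theta T - iter k.+1 theta T))).
    rewrite sumrN -(big_mkord xpredT
      (fun k => iter k.+2 theta T - iter k.+1 theta T)).
    by rewrite (telescope_sumr (fun k => iter k.+1 theta T)) // opprB.
  move=> k _; rewrite opprB /S (V_map_sub (itV k.+1)) //.
  by rewrite -iterSr.
have T0 := opnorm_ge0 (WB WT).
have ES n : opnorm (E S) <= n.+1%:R^-1 * (2 * opnorm T).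
  have n0 : 0 <= n.+1%:R^-1 :> R by rewrite invr_ge0 ler0n.
  rewrite -(psiE n S WS); apply/opnorm_leP.
  - by apply: WB; exact: V_map_in (psiV n) WS.
  - by rewrite mulr_ge0 ?mulr_ge0.
  move=> x y; rewrite psiS.
  have -> : ((n.+1%:R^-1)%:C *: (theta T - iter n.+2 theta T)) x =
    (n.+1%:R^-1)%:C *: (theta T x - iter n.+2 theta T x) by [].
  rewrite rdotZl -mulrA ler_wpM2l // rdotBl -rdotNr.
  have le k u v : rdot (iter k theta T u) v <=
      opnorm T * ((hnorm u ^+ 2 + hnorm v ^+ 2) / 2).
    have /opnorm_leP := V_map_opnorm (itV k) WT; apply => //.
    exact/WB/Wit.
  have h1 : rdot (theta T x) y <= _ := le 1%N x y.
  have h2 := le n.+2 x (- y); rewrite hnormN in h2.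
  apply: le_trans (lerD h1 h2) _; by rewrite -mulrA (mulr_natl _ 2) mulr2n.
have ES0 : E S = 0.
  apply: opnorm_eq0; first exact/WB/WE.
  apply/eqP; rewrite eq_le opnorm_ge0 ?andbT; last exact/WB/WE.
  apply/ler_addgt0Pr => e e0; rewrite add0r.
  have b0 : 0 < 2 * opnorm T + 1 by rewrite (lt_le_trans ltr01) // lerDr mulr_ge0.
  have eb : 0 < e / (2 * opnorm T + 1) by rewrite divr_gt0.
  have [n ne] := ltr_add_invr eb; rewrite add0r in ne.
  apply: le_trans (ES n) _.
  apply: (@le_trans _ _ (e / (2 * opnorm T + 1) * (2 * opnorm T + 1))).
    apply: ler_pM; [by rewrite invr_ge0 ler0n|by rewrite mulr_ge0| |].
      exact: ltW.
    by rewrite lerDl ler01.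
  by rewrite divfK // gt_eqF.
by apply/esym/eqP; rewrite -subr_eq0 -(V_map_sub EV) // ES0.
Qed.

Section Range.
Variable E : (H -> H) -> (H -> H).
Hypothesis Emin : minimal_V_projection V W E.
Let EV : V_map V W E. Proof. by case: Emin. Qed.
Let Y := E @` W.

Lemma range_fixed T : Y T -> E T = T.
Proof. by move=> [S WS <-]; exact: (minimal_V_projection_absorbs Emin V_map_id). Qed.

Lemma range_sub : Y `<=` W.
Proof. by move=> _ [S WS <-]; exact: V_map_in. Qed.

Lemma sub_range : V `<=` Y.
Proof.
move=> T VT; exists T; first exact: subset_weakstar_closure.
exact: EV.2.
Qed.

Lemma range_operator_space : operator_space Y.
Proof.
have [_ W0 WD] := Ws; have [_ V0 _] := Vs; split.
- by move=> T /range_sub/WB.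
- exact: sub_range.
- move=> a _ _ [S WS <-] [T WT <-]; exists (a *: S + T); first exact: WD.
  by have [[[_ lin] _] _] := EV; rewrite (lin _ _ _ WS WT).
Qed.

Lemma minimal_V_projection_contractive : completely_contractive W Y E.
Proof.
have [[[_ lin] ctr] _] := EV; split=> //; split=> // T WT; by exists T.
Qed.

(** The composite of [u] and [E] is a V-map, so [E] absorbs it. *)
Lemma range_rigid u : completely_contractive Y Y u ->
  (forall T, V T -> u T = T) -> forall T, Y T -> u T = T.
Proof.
move=> uc uV T YT.
have uEV : V_map V W (u \o E).
  split; last by move=> S VS /=; rewrite (EV.2 _ VS) uV.
  apply: (completely_contractive_sub (@subset_refl _ W) range_sub).
  exact: completely_contractive_comp minimal_V_projection_contractive uc.
have := minimal_V_projection_absorbs Emin uEV (range_sub YT).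
rewrite /= (range_fixed YT) (range_fixed YT) range_fixed //.
by case: uc => -[h _] _; exact: h.
Qed.

(** A weak expectation followed by [E] fixes [V], hence the whole range of [E] by
    rigidity: it is a projection of the space of all operators onto this range. *)
Lemma weak_expectation_injective :
  has_weak_expectation V -> injective_operator_space Y.
Proof.
move=> [Phi Phic PhiV].
have Pc := completely_contractive_comp Phic minimal_V_projection_contractive.
apply: (injective_of_projection range_operator_space Pc).
apply: range_rigid; last by move=> T VT /=; rewrite PhiV // (EV.2 _ VT).
by apply: (completely_contractive_sub _ (@subset_refl _ Y) Pc) => T
  /range_sub/WB.
Qed.

(** The identity of the range extends to all operators. *)
Lemma injective_weak_expectation :
  injective_operator_space Y -> has_weak_expectation V.
Proof.
move=> [Ys Yinj].
have [||psi psic psiE] := Yinj H Y _ Ys (bounded_operator_space H) _ id.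
- by move=> T /range_sub/WB.
- exact: completely_contractive_id.
exists psi.
  exact: completely_contractive_sub (@subset_refl _ _) range_sub psic.
by move=> T VT; apply: psiE; exact: sub_range.
Qed.

Lemma injective_iso_envelope :
  injective_operator_space Y -> iso_injective_envelope V Y.
Proof.
move=> Yinj; exists H, Y, id; split.
  split => //; first exact: completely_isometric_id sub_range.
  exact: range_rigid.
exists id; split=> //; first exact: completely_isometric_id.
by rewrite image_id.
Qed.

Lemma iso_envelope_injective :
  iso_injective_envelope V Y -> injective_operator_space Y.
Proof.
move=> [K [Y' [iota [[Y'inj _ _] [u [ui uY _]]]]]].
exact: injective_completely_isometric range_operator_space Y'inj ui uY.
Qed.

End Range.

End MinimalProjections.

Theorem theorem3p2 (R : realType) (H : hilbertType R) (V : set (H -> H))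
    (hV : operator_space V) :
  (exists E, minimal_V_projection V (weakstar_closure V) E) /\
  (forall E, minimal_V_projection V (weakstar_closure V) E ->
     [<-> has_weak_expectation V;
          iso_injective_envelope V (E @` weakstar_closure V);
          injective_operator_space (E @` weakstar_closure V)]).
Proof.
split; first exact: exists_minimal_V_projection.
move=> E Emin; tfae.
- by move=> /(weak_expectation_injective hV Emin)/(injective_iso_envelope hV Emin).
- exact: iso_envelope_injective.
- exact: injective_weak_expectation.
Qed.
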